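(* Every Kähler class on $M=P(\mathcal O\oplus\mathcal O(1,-1))\to\mathbb{CP}^1\times\mathbb{CP}^1$ has an admissible Kähler metric conformal to an Einstein–Maxwell metric.
   Context: $\mathcal O(1,-1)$ is the tensor product of the pullback of $\mathcal O(1)$ from the first factor and $\mathcal O(-1)$ from the second. **Admissible metrics.** Let $g_1,-g_2$ be (positive definite) constant curvature metrics on the two factors $\mathbb{CP}^1$, with associated forms $\omega_1$, $-\omega_2$, such that $[\omega_1/2\pi]=c_1(\mathcal O(1))$ and $[\omega_2/2\pi]=c_1(\mathcal O(-1))$ (pulled back). Let $K$ be the generator of the $S^1$-action on $M$ by scalar multiplication on $\mathcal O$. For $0<x_1<1$, $-1<x_2<0$, an admissible Kähler metric is (up to an overall positive scale) a Kähler structure on $M$ given, off the zero and infinity sections, by $$g=\sum_{j=1}^2\frac{1+x_jz}{x_j}g_j+\frac{dz^2}{\Theta(z)}+\Theta(z)\theta^2,\qquad\omega=\sum_{j=1}^2\frac{1+x_jz}{x_j}\omega_j+dz\wedge\theta,$$ where $z:M\to[-1,1]$ is the momentum map of $K$, $\theta$ is a connection $1$-form (from a Chern connection) with $\theta(K)=1$, $d\theta=\omega_1+\omega_2$, and $\Theta$ is smooth on $[-1,1]$, positive on $(-1,1)$, with $\Theta(\pm1)=0$, $\Theta'(\pm1)=\mp2$; the complex structure is the horizontal lift of that of the base together with $Jdz=\Theta\theta$. Up to rescaling, the classes $[\omega]$ for $(x_1,x_2)\in(0,1)\times(-1,0)$ exhaust the Kähler cone of $M$. **Einstein–Maxwell.**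 A Kähler metric $g$ is conformal to a (conformally Kähler) Einstein–Maxwell metric if there is a positive Killing potential $f$ of $g$ (i.e. $J\,\mathrm{grad}_gf$ is a Killing field) such that $h=f^{-2}g$ has constant scalar curvature; constant $f$ (i.e. $g$ itself of constant scalar curvature) is allowed. *)

(* Defs.v *)
From HB Require Import structures.
From mathcomp Require Import all_boot all_order all_algebra.
From mathcomp Require Import complex.
From mathcomp Require Import all_classical all_reals all_analysis.

Set Implicit Arguments.
Unset Strict Implicit.
Unset Printing Implicit Defensive.

Import Order.TTheory GRing.Theory Num.Theory.
Import numFieldNormedType.Exports.

Local Open Scope classical_set_scope.
Local Open Scope ring_scope.
Local Open Scope complex_scope.

(* Tensor calculus in a coordinate system of R^n.  Vectors and 1-forms are row
   vectors of components; a bilinear form b is the matrix of the b(e_i, e_j);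
   an endomorphism acts on row vectors on the right, so that row i of its
   matrix is the image of e_i. *)
Section LocalTensors.
Context {R : realType} {n : nat}.
Notation E := 'rV[R]_n.+1.
Implicit Types (f : E -> R) (g : E -> 'M[R]_n.+1) (X : E -> E) (p : E).

Definition partial (i : 'I_n.+1) f p : R := 'D_(delta_mx 0 i) f p.

(* C^infinity on the whole of R^n *)
Definition smooth f : Prop :=
  forall (s : seq 'I_n.+1) p, differentiable (foldr partial f s) p.

Definition gradient g f p : E :=
  (\row_i partial i f p) *m invmx (g p).

(* christoffel g k i j is the symbol with upper index k *)
Definition christoffel g (k i j : 'I_n.+1) p : R :=
  2^-1 * \sum_l invmx (g p) k l *
    (partial i (fun q => g q j l) p + partial j (fun q => g q i l) p
     - partial l (fun q => g q i j) p).

Definition ricci g (i j : 'I_n.+1) p : R :=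
  \sum_k (partial k (christoffel g k i j) p - partial j (christoffel g k i k) p)
  + \sum_k \sum_l (christoffel g k k l p * christoffel g l i j p
                   - christoffel g k j l p * christoffel g l i k p).

Definition scalar_curvature g p : R :=
  \sum_i \sum_j invmx (g p) i j * ricci g i j p.

Definition lie_derivative X g p : 'M[R]_n.+1 :=
  \matrix_(i, j) \sum_k
    (X p 0 k * partial k (fun q => g q i j) p
     + g p k j * partial i (fun q => X q 0 k) p
     + g p i k * partial j (fun q => X q 0 k) p).

Definition killing_on (U : set E) X g : Prop :=
  forall p, U p -> lie_derivative X g p = 0.

(* the 2-form g(J., .) *)
Definition kahler_form g (J : E -> 'M[R]_n.+1) p : 'M[R]_n.+1 := J p *m g p.

Definition dx (i : 'I_n.+1) : E := delta_mx 0 i.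

Definition sqform (a : E) : 'M[R]_n.+1 := a^T *m a.

Definition wedge (a b : E) : 'M[R]_n.+1 := a^T *m b - b^T *m a.

End LocalTensors.

(* The threefold M = P(O + O(1,-1)) over CP^1 x CP^1, in homogeneous
   coordinates (a, b, (o, l)): a and b are homogeneous coordinates on the two
   factors, o and l are the components along O and O(1,-1); a section of O(k)
   over CP^1 is a function of a homogeneous of degree k. *)
Section Threefold.
Context {R : realType}.
Notation C := R[i].
Notation E := 'rV[R]_6.

Definition hcoord : Type := (C * C) * (C * C) * (C * C).

Definition valid (p : hcoord) : Prop :=
  [/\ p.1.1 != (0, 0), p.1.2 != (0, 0) & p.2 != (0, 0)].

Definition same_point (p q : hcoord) : Prop :=
  exists lam mu nu : C, [/\ lam != 0, mu != 0, nu != 0 &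
    q = ((lam * p.1.1.1, lam * p.1.1.2), (mu * p.1.2.1, mu * p.1.2.2),
         (nu * p.2.1, nu * (lam * mu^-1) * p.2.2))].

(* f descends to a function on M *)
Definition function_on_M (f : hcoord -> R) : Prop :=
  forall p q, valid p -> valid q -> same_point p q -> f p = f q.

(* the two affine coordinates on CP^1 *)
Definition affine (b : bool) (w : C) : C * C := if b then (w, 1) else (1, w).

(* The six real coordinates in a chart C^3 are x1, y1, x2, y2, x3, y3. *)
Definition chart (c : bool * bool * bool) (p : E) : hcoord :=
  (affine c.1.1 (p 0 0 +i* p 0 1), affine c.1.2 (p 0 2 +i* p 0 3),
   affine c.2 (p 0 4 +i* p 0 5)).

Definition smooth_on_M (f : hcoord -> R) : Prop :=
  function_on_M f /\ forall c, smooth (f \o chart c).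

(* Momentum-angle coordinates (x1, y1, x2, y2, z, t) on the complement of the
   zero and infinity sections, over the product of affine charts c of the base.
   The fibre coordinate v = o / l has argument t, on which the S^1-action by
   scalar multiplication on O is translation, and its norm for the hermitian
   metric induced by the Fubini-Study metrics,
     |v| * sqrt ((1 + |w1|^2) / (1 + |w2|^2)),
   is a function kappa of the momentum z. *)
Definition normsq (i j : 'I_6) (p : E) : R := (p 0 i) ^+ 2 + (p 0 j) ^+ 2.

Definition momentum_chart (kappa : R -> R) (c : bool * bool) (p : E) : hcoord :=
  let r := kappa (p 0 4) *
    Num.sqrt ((1 + normsq 2 3 p) / (1 + normsq 0 1 p)) in
  (affine c.1 (p 0 0 +i* p 0 1), affine c.2 (p 0 2 +i* p 0 3),
   ((r * cos (p 0 5)) +i* (r * sin (p 0 5)), 1)).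

Definition momentum_domain : set E := [set p | -1 < p 0 4 < 1].

End Threefold.

(* Admissible Kaehler structures.  All the expressions below are the same in
   the four choices of affine charts of the base. *)
Section Admissible.
Context {R : realType}.
Notation E := 'rV[R]_6.
Implicit Types (Theta kappa : R -> R) (p : E).

(* The Fubini-Study form of area 2 pi on the factor with coordinates (i, j),
   and its metric. *)
Definition fs_metric (i j : 'I_6) p : 'M[R]_6 :=
  (2 / (1 + normsq i j p) ^+ 2) *: (sqform (dx i) + sqform (dx j)).

Definition fs_form (i j : 'I_6) p : 'M[R]_6 :=
  (2 / (1 + normsq i j p) ^+ 2) *: wedge (dx i) (dx j).

(* a primitive of fs_form *)
Definition fs_connection (i j : 'I_6) p : E :=
  (1 + normsq i j p)^-1 *: (p 0 i *: dx j - p 0 j *: dx i).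

(* omega_1 and - omega_2 are the Fubini-Study forms *)
Definition g1 p := fs_metric 0 1 p.
Definition g2 p := - fs_metric 2 3 p.
Definition omega1 p := fs_form 0 1 p.
Definition omega2 p := - fs_form 2 3 p.

(* d theta = omega_1 + omega_2 and theta (d/dt) = 1 *)
Definition theta p : E := dx 5 + fs_connection 0 1 p - fs_connection 2 3 p.

Definition admissible_metric (s x1 x2 : R) Theta p : 'M[R]_6 :=
  let z := p 0 4 in
  s *: (((1 + x1 * z) / x1) *: g1 p + ((1 + x2 * z) / x2) *: g2 p
        + (Theta z)^-1 *: sqform (dx 4) + Theta z *: sqform (theta p)).

Definition admissible_form (s x1 x2 : R) p : 'M[R]_6 :=
  let z := p 0 4 in
  s *: (((1 + x1 * z) / x1) *: omega1 p + ((1 + x2 * z) / x2) *: omega2 p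
        + wedge (dx 4) (theta p)).

Definition horizontal_lift p (Y : E) : E := Y - (Y *m (theta p)^T) *m dx 5.

(* Horizontal lift of the complex structure of the base, together with
   J dz = Theta theta where J acts on 1-forms by J a = - a o J, i.e.
   J (d/dz) = Theta^-1 d/dt and J (d/dt) = - Theta d/dz. *)
Definition admissible_J Theta p : 'M[R]_6 :=
  (dx 0)^T *m horizontal_lift p (dx 1) - (dx 1)^T *m horizontal_lift p (dx 0)
  + (dx 2)^T *m horizontal_lift p (dx 3) - (dx 3)^T *m horizontal_lift p (dx 2)
  + (Theta (p 0 4))^-1 *: ((dx 4)^T *m dx 5)
  - Theta (p 0 4) *: ((theta p)^T *m dx 4).

(* Smoothness on [-1, 1] is that of a C^infinity extension to a neighbourhood. *)
Definition momentum_profile Theta : Prop :=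
  [/\ exists2 e : R, 0 < e & forall (k : nat) (z : R), -1 - e < z < 1 + e ->
        derivable (Theta^`(k))%classic z 1,
      forall z : R, -1 < z < 1 -> 0 < Theta z,
      Theta (-1) = 0 /\ Theta 1 = 0 &
      (Theta^`() (-1) = 2 /\ Theta^`() 1 = -2)%classic].

(* J dz = Theta theta determines, up to a constant factor, the norm kappa of
   the holomorphic fibre coordinate as a function of z: d log kappa = dz / Theta. *)
Definition fibre_norm Theta kappa : Prop :=
  forall z : R, -1 < z < 1 ->
    0 < kappa z /\ is_derive z (1 : R) kappa (kappa z / Theta z).

End Admissible.

(* A Kaehler structure with metric g and complex structure J, given on the
   complement of the zero and infinity sections in momentum-angle coordinates,
   is conformal to an Einstein-Maxwell metric. *)
Definition conformal_to_einstein_maxwell (R : realType) (kappa : R -> R)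
    (g J : 'rV[R]_6 -> 'M[R]_6) : Prop :=
  exists f : hcoord -> R,
    [/\ smooth_on_M f,
        forall p : hcoord, valid p -> 0 < f p,
        forall c, let F := f \o momentum_chart kappa c in
          killing_on momentum_domain (fun p => gradient g F p *m J p) g &
        exists scal : R, forall c p, momentum_domain p ->
          let F := f \o momentum_chart kappa c in
          scalar_curvature (fun q => (F q) ^- 2 *: g q) p = scal].

(* Main.v *)
(* Take the Killing potential f = 1 + c z with |c| < 1 and Theta = F / p,
   p = (1 + x1 z) (1 + x2 z).  The metric f^-2 g has constant scalar curvature
   S / s if and only if
     f^2 F'' - 10 c f F' + 30 c^2 F = 4 (x1 - x2) f^2 - S p,
   whose polynomial solutions of the form F = (1 - z^2) (p + (1 - z^2) k), k
   quadratic, satisfy all the boundary conditions.  The unknowns k and S enter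
   linearly, and the system is solvable when a polynomial in c that changes sign
   between -1 and 1 vanishes.  Positivity of F holds since G = F / f^5 has
   G'' = f^-7 q with q a convex quadratic polynomial.  The fibre norm is the
   square root of (1 + z) / (1 - z) exp (- 2 int k / H), H = F / (1 - z^2), and
   the momentum is a smooth function of it because it solves an autonomous
   differential equation that is regular at the zero and infinity sections. *)
Require Import Defs.
From mathcomp Require Import all_boot all_order all_algebra.
From mathcomp Require Import complex ring lra.
From mathcomp Require Import all_classical all_reals all_analysis.

Set Implicit Arguments.
Unset Strict Implicit.
Unset Printing Implicit Defensive.

Import Order.TTheory GRing.Theory Num.Theory.
Import numFieldNormedType.Exports.

Local Open Scope classical_set_scope.
Local Open Scope ring_scope.

(** * The Einstein-Maxwell equation on profiles *)

(** With f = 1 + c z, the operator f^2 F'' - 10 c f F' + 30 c^2 F equals f^7 (F / f^5)'', and for c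
    <> 0 its kernel is spanned by f^5 and f^6. Hence all solutions are polynomials of degree at most
    6, which is the degree of F when k is quadratic. The values of F and F' at both ends are
    prescribed: four conditions for two integration constants, S and c. Integrating (F / f^5)'' over
    [-1, 1] fixes S, and the remaining condition, nonlinear in c, is met by the intermediate value
    theorem.

    The curvature is defined by Christoffel symbols in six real coordinates. It is evaluated by
    computation: all tensor entries are Laurent polynomials with integer coefficients in functions
    whose derivatives are again such polynomials. *)

Section Solve.
Variable R : rcfType.
Implicit Types a b f n c sg pp dl : R.

Lemma affine_gt0 (t z : R) : -1 < t < 1 -> -1 <= z <= 1 -> 0 < 1 + t * z.
Proof.
by move=> /andP[? ?] /andP[? ?]; have [c0|c0] := leP 0 t; nra.
Qed.

(* Three linear equations in two unknowns: since n annihilates the column a, the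
   equations combined with weights n determine S, and what remains is a
   multiple of a as soon as the augmented determinant vanishes. *)
Lemma rank_one_system a1 a2 a3 b1 b2 b3 f1 f2 f3 n1 n2 n3 :
  n3 != 0 -> b1 * n1 + b2 * n2 + b3 * n3 != 0 ->
  a1 * n1 + a2 * n2 + a3 * n3 = 0 -> 0 < a1 ^+ 2 + a2 ^+ 2 ->
  a1 * (b2 * f3 - b3 * f2) - b1 * (a2 * f3 - a3 * f2)
    + f1 * (a2 * b3 - a3 * b2) = 0 ->
  exists e, let S := - (f1 * n1 + f2 * n2 + f3 * n3) /
                     (b1 * n1 + b2 * n2 + b3 * n3) in
    [/\ a1 * e + b1 * S + f1 = 0, a2 * e + b2 * S + f2 = 0
      & a3 * e + b3 * S + f3 = 0].
Proof.
move=> n3n0 bn0 an0 N0 det0.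
set S := - _ / _.
pose v1 := b1 * S + f1; pose v2 := b2 * S + f2; pose v3 := b3 * S + f3.
have vn0 : v1 * n1 + v2 * n2 + v3 * n3 = 0.
  rewrite /v1 /v2 /v3 /S; field; exact: bn0.
have cross : a1 * v2 = a2 * v1.
  apply/eqP; rewrite -subr_eq0; apply/eqP; apply: (mulIf bn0); rewrite mul0r.
  transitivity (- n3 * (a1 * (b2 * f3 - b3 * f2) - b1 * (a2 * f3 - a3 * f2)
    + f1 * (a2 * b3 - a3 * b2))
    + (b1 * v2 - b2 * v1) * (a1 * n1 + a2 * n2 + a3 * n3)
    + (a1 * b2 - a2 * b1) * (v1 * n1 + v2 * n2 + v3 * n3)).
    by rewrite /v1 /v2 /v3; ring.
  by rewrite det0 an0 vn0; ring.
have Nn0 : a1 ^+ 2 + a2 ^+ 2 != 0 by rewrite gt_eqF.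
exists (- (a1 * v1 + a2 * v2) / (a1 ^+ 2 + a2 ^+ 2)).
set e := _ / _.
have e1 : a1 * e + v1 = 0.
  transitivity (a2 * (a2 * v1 - a1 * v2) / (a1 ^+ 2 + a2 ^+ 2)).
    by rewrite /e; field.
  by rewrite cross subrr mulr0 mul0r.
have e2 : a2 * e + v2 = 0.
  transitivity (a1 * (a1 * v2 - a2 * v1) / (a1 ^+ 2 + a2 ^+ 2)).
    by rewrite /e; field.
  by rewrite cross subrr mulr0 mul0r.
have e3 : a3 * e + v3 = 0.
  apply: (mulIf n3n0); rewrite mul0r.
  transitivity (e * (a1 * n1 + a2 * n2 + a3 * n3) + (v1 * n1 + v2 * n2 + v3 * n3)
     - n1 * (a1 * e + v1) - n2 * (a2 * e + v2)); first by ring.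
  by rewrite an0 vn0 e1 e2; ring.
by split; rewrite -?addrA.
Qed.

(* Up to the factor 32 (10 - 6 c^2)^2, the determinant in c of the linear system
   solved in [em_coeffs_exist]; sg, pp, dl are x1 + x2, x1 x2, x1 - x2. *)
Definition det_poly (sg pp dl : R) : {poly R} := Poly [::
  - 15 * sg + 15 * sg * dl;
  60 - 30 * dl + 66 * pp - 38 * pp * dl + 6 * pp ^+ 2 + 15 * sg ^+ 2;
  - 159 * sg + 2 * sg * dl - 105 * sg * pp;
  72 + 34 * dl + 162 * pp + 50 * pp * dl + 90 * pp ^+ 2 + 123 * sg ^+ 2;
  - 165 * sg - 20 * sg * dl - 225 * sg * pp;
  60 - 10 * dl + 150 * pp - 18 * pp * dl + 90 * pp ^+ 2 + 45 * sg ^+ 2;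
  - 45 * sg + 6 * sg * dl - 51 * sg * pp;
  6 * dl + 6 * pp + 6 * pp * dl + 6 * pp ^+ 2 + 9 * sg ^+ 2;
  - 3 * sg * dl - 3 * sg * pp].

Lemma det_poly_root x1 x2 : 0 < x1 < 1 -> -1 < x2 < 0 ->
  exists2 c : R, -1 < c < 1 & (det_poly (x1 + x2) (x1 * x2) (x1 - x2)).[c] = 0.
Proof.
move=> /andP[x1_gt0 x1_lt1] /andP[x2_gtN1 x2_lt0]; set D := det_poly _ _ _.
(* For c = 1 and c = -1 the function 1 + c z vanishes at one end of [-1, 1], and up to a constant
   the determinant is the square of p at that end. Being nonzero, it keeps the root c inside the
   open interval. *)
have D1 : D.[1] = 192 * ((1 - x1) * (1 - x2)) ^+ 2.
  by rewrite horner_Poly /=; ring.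
have DN1 : D.[-1] = - 192 * ((1 + x1) * (1 + x2)) ^+ 2.
  by rewrite horner_Poly /=; ring.
have D1_gt0 : 0 < D.[1].
  by rewrite D1 mulr_gt0 ?ltr0n// exprn_gt0// mulr_gt0// subr_gt0//; lra.
have DN1_lt0 : D.[-1] < 0.
  by rewrite DN1 nmulr_rlt0 ?oppr_lt0 ?ltr0n// exprn_gt0// mulr_gt0//; lra.
have N1_le1 : (-1 : R) <= 1 by lra.
have D_change : D.[-1] <= 0 <= D.[1] by rewrite !ltW.
have [c /andP[c1 c2] /rootP Dc0] := Num.Theory.poly_ivt N1_le1 D_change.
exists c => //; rewrite !lt_neqAle c1 c2 !andbT; apply/andP; split.
  by apply: contra_ltN DN1_lt0 => /eqP ->; rewrite Dc0.
by apply: contra_ltN D1_gt0 => /eqP <-; rewrite Dc0.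
Qed.

(* The coefficients of (1 - z^2) (p + (1 - z^2) (k0 + k1 z + k2 z^2)), where
   p = 1 + sg z + pp z^2. *)
Definition em_coeffs (sg pp k0 k1 k2 : R) : seq R :=
  [:: 1 + k0; sg + k1; pp - 1 - 2 * k0 + k2; - sg - 2 * k1;
      k0 - 2 * k2 - pp; k1; k2].

(* This is 15/2 (1 - c^2)^6 times the integral of p (1 + c z)^-7 over [-1, 1];
   being affine in x1 and in x2, it need only be estimated at x1, x2 = +-1. *)
Lemma moment_gt0 c x1 x2 : -1 < c < 1 -> 0 < x1 < 1 -> -1 < x2 < 0 ->
  0 < (15 + 50 * c ^+ 2 + 15 * c ^+ 4)
      - (x1 + x2) * (35 * c + 42 * c ^+ 3 + 3 * c ^+ 5)
      + x1 * x2 * (5 + 54 * c ^+ 2 + 21 * c ^+ 4).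
Proof.
move=> /andP[c1 c2] /andP[u1 u2] /andP[v1 v2].
have corner (t : R) : -1 < t < 1 ->
    0 < 20 - 30 * t + 24 * t ^+ 2 - 6 * t ^+ 3.
  move=> /andP[t1 t2].
  have -> : 20 - 30 * t + 24 * t ^+ 2 - 6 * t ^+ 3 =
     8 + 6 * (1 - t) ^+ 3 + 6 * (1 - t) ^+ 2 by ring.
  have h : 0 < 1 - t by lra.
  have := exprn_gt0 3 h; have := exprn_gt0 2 h; lra.
have sqlt1 : c ^+ 2 < 1 by nra.
have Epp : 0 < (1 - c) ^+ 2 * (20 - 30 * c + 24 * c ^+ 2 - 6 * c ^+ 3).
  by rewrite mulr_gt0 ?exprn_gt0 ?corner; lra.
have Emm : 0 < (1 + c) ^+ 2 * (20 - 30 * (- c) + 24 * (- c) ^+ 2 - 6 * (- c) ^+ 3).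
  by rewrite mulr_gt0 ?exprn_gt0 ?corner; lra.
have Epm : 0 < 10 - 4 * c ^+ 2 - 6 * (c ^+ 2) ^+ 2 by nra.
have p1 : 0 < (1 + x1) * (1 + x2) by rewrite mulr_gt0; lra.
have p2 : 0 < (1 - x1) * (1 - x2) by rewrite mulr_gt0; lra.
have p3 : 0 < (1 + x1) * (1 - x2) + (1 - x1) * (1 + x2).
  by rewrite addr_gt0// mulr_gt0; lra.
rewrite -(pmulr_rgt0 _ (_ : 0 < 4)) ?ltr0n//.
have -> : 4 * ((15 + 50 * c ^+ 2 + 15 * c ^+ 4)
      - (x1 + x2) * (35 * c + 42 * c ^+ 3 + 3 * c ^+ 5)
      + x1 * x2 * (5 + 54 * c ^+ 2 + 21 * c ^+ 4))
  = (1 + x1) * (1 + x2) * ((1 - c) ^+ 2 * (20 - 30 * c + 24 * c ^+ 2 - 6 * c ^+ 3))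
  + (1 - x1) * (1 - x2)
    * ((1 + c) ^+ 2 * (20 - 30 * (- c) + 24 * (- c) ^+ 2 - 6 * (- c) ^+ 3))
  + ((1 + x1) * (1 - x2) + (1 - x1) * (1 + x2)) * (10 - 4 * c ^+ 2 - 6 * (c ^+ 2) ^+ 2)
  by ring.
by apply: addr_gt0; [apply: addr_gt0|]; exact: mulr_gt0.
Qed.

Lemma biquadratic_gt0 (p q r x : R) : 0 < p -> 0 <= q -> 0 <= r ->
  0 < p + q * x ^+ 2 + r * (x ^+ 2) ^+ 2.
Proof. by move=> p0 q0 r0; rewrite !ltr_wpDr// mulr_ge0// sqr_ge0. Qed.

(* The numerator of S, up to a positive factor; it is affine in x1 and in x2,
   hence a convex combination of its values for x1 = 0, 1 and x2 = -1, 0. *)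
Lemma source_gt0 c x1 x2 : -1 < c < 1 -> 0 < x1 < 1 -> -1 < x2 < 0 ->
  0 < 30 + 60 * (x1 - x2) + 30 * (x1 * x2) - 150 * c * (x1 + x2)
    + 300 * c ^+ 2 + 300 * c ^+ 2 * (x1 * x2) - 300 * c ^+ 3 * (x1 + x2)
    + 150 * c ^+ 4 - 60 * c ^+ 4 * (x1 - x2) + 150 * c ^+ 4 * (x1 * x2)
    - 30 * c ^+ 5 * (x1 + x2).
Proof.
move=> /andP[c1 c2] /andP[u1 u2] /andP[v1 v2].
have A1 : 0 < (1 - x1) * (1 + x2) by rewrite mulr_gt0; lra.
have A2 : 0 < (1 - x1) * - x2 by rewrite mulr_gt0; lra.
have A3 : 0 < x1 * (1 + x2) by rewrite mulr_gt0; lra.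
have A4 : 0 < x1 * - x2 by rewrite mulr_gt0; lra.
have corner (t : R) : -1 < t < 1 ->
    0 < 90 + 150 * t + 300 * t ^+ 2 + 300 * t ^+ 3 + 90 * t ^+ 4 + 30 * t ^+ 5.
  move=> /andP[t1 t2].
  have -> : 90 + 150 * t + 300 * t ^+ 2 + 300 * t ^+ 3 + 90 * t ^+ 4 + 30 * t ^+ 5
    = (1 + t) * (30 * (t ^+ 2 + t) ^+ 2 + 210 * (t + 1 / 7) ^+ 2 + 600 / 7)
    by field.
  apply: mulr_gt0; first by lra.
  by have := sqr_ge0 (t ^+ 2 + t); have := sqr_ge0 (t + 1 / 7); lra.
have sqlt1 : c ^+ 2 < 1 by nra.
have q1 := corner c; have q2 := corner (- c).
set T := (X in 0 < X).
have -> : T = (1 - x1) * (1 + x2) * (30 + 300 * c ^+ 2 + 150 * (c ^+ 2) ^+ 2)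
  + (1 - x1) * (- x2)
    * (90 + 150 * c + 300 * c ^+ 2 + 300 * c ^+ 3 + 90 * c ^+ 4 + 30 * c ^+ 5)
  + x1 * (1 + x2)
    * (90 + 150 * (- c) + 300 * (- c) ^+ 2 + 300 * (- c) ^+ 3 + 90 * (- c) ^+ 4
       + 30 * (- c) ^+ 5)
  + x1 * (- x2) * (120 * (1 - c ^+ 2) * (1 + c ^+ 2)) by rewrite /T; ring.
have B1 : 0 < 30 + 300 * c ^+ 2 + 150 * (c ^+ 2) ^+ 2.
  by apply: biquadratic_gt0; rewrite ?ler0n ?ltr0n.
have {}q1 := q1 (introT andP (conj c1 c2)).
have {}q2 : 0 < 90 + 150 * - c + 300 * (- c) ^+ 2 + 300 * (- c) ^+ 3
    + 90 * (- c) ^+ 4 + 30 * (- c) ^+ 5 by apply: q2; lra.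
have B4 : 0 < 120 * (1 - c ^+ 2) * (1 + c ^+ 2).
  apply: mulr_gt0; last by rewrite ltr_wpDr ?sqr_ge0.
  by apply: mulr_gt0; rewrite ?subr_gt0 ?ltr0n.
have H1 := mulr_gt0 A1 B1; have H2 := mulr_gt0 A2 q1.
have H3 := mulr_gt0 A3 q2; have H4 := mulr_gt0 A4 B4.
exact: addr_gt0 (addr_gt0 (addr_gt0 H1 H2) H3) H4.
Qed.

(** Comparing coefficients leaves three equations for two unknowns, which is why c has to be a root
    of the determinant. The sign of S is recorded for the convexity argument in [em_profile]. *)
Lemma em_coeffs_exist x1 x2 : 0 < x1 < 1 -> -1 < x2 < 0 ->
  exists c S k0 k1 k2, let al i := nth 0 (em_coeffs (x1 + x2) (x1 * x2) k0 k1 k2) i in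
  [/\ -1 < c < 1, 0 < S &
   forall z, let F0 := \sum_(i < 7) al i * z ^+ i in
     let F1 := \sum_(i < 6) i.+1%:R * al i.+1 * z ^+ i in
     let F2 := \sum_(i < 5) (i.+1 * i.+2)%:R * al i.+2 * z ^+ i in
     (1 + c * z) ^+ 2 * F2 - 10 * c * (1 + c * z) * F1 + 30 * c ^+ 2 * F0
     = 4 * (x1 - x2) * (1 + c * z) ^+ 2 - S * ((1 + x1 * z) * (1 + x2 * z))].
Proof.
move=> hx1 hx2.
have [c c_itv] := det_poly_root hx1 hx2.
rewrite horner_Poly /= => det0.
have mom := moment_gt0 c_itv hx1 hx2.
have src := source_gt0 c_itv hx1 hx2.
move: (c_itv) => /andP[c1 c2].
move: det0 mom src.
set sg := x1 + x2; set pp := x1 * x2; set dl := x1 - x2 => det0 mom src.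
have c21 : c ^+ 2 < 1 by nra.
pose W := 10 - 6 * c ^+ 2; have W0 : 0 < W by rewrite /W; lra.
(* The coefficients of z^5 and z^6 in the equation vanish identically, those of
   z^3 and z^4 express k1 and k2 by e = k0 - 2 k2 - pp, and those of 1, z, z^2,
   multiplied by W, are the system solved below for e and S. *)
pose f1 := - 20 - 40 * dl - 20 * pp - 100 * c * sg + 312 * c ^+ 2
  + 24 * c ^+ 2 * dl + 312 * c ^+ 2 * pp + 24 * c ^+ 3 * sg - 180 * c ^+ 4
  - 180 * c ^+ 4 * pp + 60 * c ^+ 5 * sg.
pose f2 := - 60 * sg + 160 * c - 80 * c * dl + 160 * c * pp + 200 * c ^+ 2 * sg
  - 96 * c ^+ 3 + 48 * c ^+ 3 * dl - 96 * c ^+ 3 * pp - 12 * c ^+ 4 * sg.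
pose f3 := 180 * c * sg - 120 * c ^+ 2 - 40 * c ^+ 2 * dl - 120 * c ^+ 2 * pp
  + 72 * c ^+ 4 + 24 * c ^+ 4 * dl + 72 * c ^+ 4 * pp - 36 * c ^+ 5 * sg.
pose a1 := -40 + 232 * c ^+ 2 - 312 / 5 * c ^+ 4 + 24 * c ^+ 6.
pose a2 := 224 * c + 64 * c ^+ 3 + 96 / 5 * c ^+ 5.
pose a3 := 120 - 24 * c ^+ 2 + 72 * c ^+ 4 - 72 / 5 * c ^+ 6.
(* Up to the factor 15/2 (1 - c^2)^6, these are the integrals of 1, z, z^2 against (1 + c z)^-7.
   They annihilate the column a because it comes from a multiple of (1 - z^2)^2, for which F / (1 +
   c z)^5 has zero derivative at both ends. *)
pose n1 := 15 + 50 * c ^+ 2 + 15 * c ^+ 4.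
pose n2 := - (35 * c + 42 * c ^+ 3 + 3 * c ^+ 5).
pose n3 := 5 + 54 * c ^+ 2 + 21 * c ^+ 4.
have n3n0 : n3 != 0.
  have -> : n3 = 5 + 54 * c ^+ 2 + 21 * (c ^+ 2) ^+ 2 by rewrite /n3; ring.
  by apply/lt0r_neq0/biquadratic_gt0; rewrite ?ler0n ?ltr0n.
have bn : 0 < W * n1 + W * sg * n2 + W * pp * n3.
  have -> : W * n1 + W * sg * n2 + W * pp * n3 = W * (n1 - sg * (- n2) + pp * n3) by ring.
  by rewrite mulr_gt0// /n2 opprK.
have an0 : a1 * n1 + a2 * n2 + a3 * n3 = 0.
  by rewrite /a1 /a2 /a3 /n1 /n2 /n3; field.
have Nn0 : 0 < a1 ^+ 2 + a2 ^+ 2.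
  have [c0|c0] := eqVneq c 0.
    have -> : a1 ^+ 2 + a2 ^+ 2 = 1600 by rewrite /a1 /a2 c0; field.
    by rewrite ltr0n.
  have -> : a2 = c * (224 + 64 * c ^+ 2 + 96 / 5 * (c ^+ 2) ^+ 2).
    by rewrite /a2; ring.
  apply: ltr_wpDl; first exact: sqr_ge0.
  rewrite lt_neqAle sqr_ge0 andbT eq_sym; apply: expf_neq0; apply: mulf_neq0 c0 _.
  by apply/lt0r_neq0/biquadratic_gt0; rewrite ?divr_ge0 ?ler0n ?ltr0n.
have [||e] := @rank_one_system a1 a2 a3 W (W * sg) (W * pp) f1 f2 f3 n1 n2 n3
  n3n0 _ an0 Nn0.
- by rewrite gt_eqF.
- move/(congr1 ( *%R (32 * W ^+ 2))): det0; rewrite mulr0 => <-.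
  rewrite /a1 /a2 /a3 /W /f1 /f2 /f3.
  by field.
set S := _ / _ => -[e1 e2 e3].
have S0 : 0 < S.
  rewrite divr_gt0//.
  have -> : - (f1 * n1 + f2 * n2 + f3 * n3) = W * (1 - c ^+ 2) *
   (30 + 60 * dl + 30 * pp - 150 * c * sg
    + 300 * c ^+ 2 + 300 * c ^+ 2 * pp - 300 * c ^+ 3 * sg
    + 150 * c ^+ 4 - 60 * c ^+ 4 * dl + 150 * c ^+ 4 * pp
    - 30 * c ^+ 5 * sg).
    by rewrite /W /f1 /f2 /f3 /n1 /n2 /n3; ring.
  by rewrite !mulr_gt0// subr_gt0.
have Wn0 : 10 - 6 * c ^+ 2 != 0 by rewrite gt_eqF.
pose k1 := (8 * c * e + 3 * c ^+ 2 * sg) / W.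
pose k2 := (5 * c * k1 - c ^+ 2 * e) / 15.
pose k0 := e + 2 * k2 + pp.
exists c, S, k0, k1, k2; split=> // z /=.
rewrite !big_ord_recl !big_ord0 /= /bump /=.
apply/eqP; rewrite -subr_eq0; apply/eqP.
transitivity (((a1 * e + W * S + f1) + (a2 * e + W * sg * S + f2) * z
   + (a3 * e + W * pp * S + f3) * z ^+ 2) / W); last first.
  by rewrite e1 e2 e3 !(mul0r, addr0).
clearbody S; rewrite /a1 /a2 /a3 /f1 /f2 /f3 /k0 /k2 /k1 /dl /pp /sg /W.
by field.
Qed.

End Solve.

(** * Differentiation rules along a direction, pointwise and with products in place of scalings *)

Section DeriveFun.
Variables (R : realType) (V : normedModType R).
Implicit Types (f g : V -> R) (x v : V) (a b : R).

Lemma is_derive_addf f g x v a b : is_derive x v f a -> is_derive x v g b ->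
  is_derive x v (fun y => f y + g y) (a + b).
Proof. by move=> fa gb; exact: (is_deriveD fa gb). Qed.

Lemma is_derive_oppf f x v a : is_derive x v f a ->
  is_derive x v (fun y => - f y) (- a).
Proof. by move=> fa; exact: (is_deriveN fa). Qed.

Lemma is_derive_mulf f g x v a b : is_derive x v f a -> is_derive x v g b ->
  is_derive x v (fun y => f y * g y) (a * g x + f x * b).
Proof.
move=> fa gb; apply: is_derive_eq (is_deriveM fa gb) _.
by rewrite /= /GRing.scale /=; ring.
Qed.

Lemma is_derive_expf f n x v a : is_derive x v f a ->
  is_derive x v (fun y => f y ^+ n) (n%:R * f x ^+ n.-1 * a).
Proof.
move=> fa; have -> : (fun y => f y ^+ n) = f ^+ n by apply/funext => y; rewrite fctE.
exact: (is_deriveX n fa).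
Qed.

Lemma is_derive_invf f x v a : f x != 0 -> is_derive x v f a ->
  is_derive x v (fun y => (f y)^-1) (- a / f x ^+ 2).
Proof.
move=> fx0 [fD <-]; apply: DeriveDef; first exact: derivableV.
by rewrite deriveV// /GRing.scale /=; ring.
Qed.

End DeriveFun.

(** * Positivity of the profile *)

Section Profile.
Variable R : realType.
Implicit Types (c S z : R) (p q F H : {poly R}).

Lemma is_derive_ratio (p q : {poly R}) z : q.[z] != 0 ->
  is_derive z 1 (fun y => p.[y] / q.[y])
    ((p^`().[z] * q.[z] - p.[z] * q^`().[z]) / q.[z] ^+ 2).
Proof.
move=> q0.
apply: is_derive_eq (is_derive_mulf (is_derive_poly p z)
  (is_derive_invf q0 (is_derive_poly q z))) _.
by field.
Qed.

Lemma MVT_itv (f df : R -> R) (a b : R) : a < b ->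
  (forall x : R, a <= x <= b -> is_derive x 1 f (df x)) ->
  exists2 c, a < c < b & f b - f a = df c * (b - a).
Proof.
move=> ab fdf.
have [x xab||c] := @MVT R f df a b ab.
- by apply: fdf; rewrite !ltW// (itvP xab).
- apply: derivable_within_continuous => x xab.
  by have [] := fdf x; rewrite ?(itvP xab).
- by rewrite in_itv /= => cab ->; exists c.
Qed.

(* G starts and ends at 0 going inwards; a nonpositive value in between forces
   the second derivative to be negative, positive and negative in turn. *)
Lemma gt0_of_second_derivative (G G1 G2 : R -> R) (z0 : R) :
  (forall z : R, -1 <= z <= 1 -> is_derive z 1 G (G1 z)) ->
  (forall z : R, -1 <= z <= 1 -> is_derive z 1 G1 (G2 z)) ->
  G (-1) = 0 -> G 1 = 0 -> -1 < z0 < 1 ->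
  (exists2 a, -1 < a < z0 & 0 < G a) -> (exists2 b, z0 < b < 1 & 0 < G b) ->
  (forall u v w, -1 <= u -> u < v -> v < w -> w <= 1 ->
     G2 u < 0 -> G2 w < 0 -> G2 v <= 0) ->
  0 < G z0.
Proof.
move=> dG dG1 GN1 G1E /andP[z01 z02] [a /andP[a1 a2] Ga] [b /andP[b1 b2] Gb] conc.
rewrite ltNge; apply/negP => Gz0.
have mvt (f df : R -> R) (u v : R) :
    (forall z : R, -1 <= z <= 1 -> is_derive z 1 f (df z)) ->
    -1 <= u -> u < v -> v <= 1 ->
    exists c, [/\ u < c, c < v & f v - f u = df c * (v - u)].
  move=> fd u1 uv v1; have [|c /andP[? ?] ?] := @MVT_itv f df u v uv.
    move=> x /andP[x1 x2]; apply: fd.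
    by rewrite (le_trans u1 x1) (le_trans x2 v1).
  by exists c.
have up (f df : R -> R) (u v : R) :
    (forall z : R, -1 <= z <= 1 -> is_derive z 1 f (df z)) ->
    -1 <= u -> u < v -> v <= 1 -> f u < f v -> exists c, [/\ u < c, c < v & 0 < df c].
  move=> fd u1 uv v1; have [c [uc cv e]] := mvt _ _ _ _ fd u1 uv v1.
  by rewrite -subr_gt0 e pmulr_lgt0 ?subr_gt0// => dfc; exists c.
have down (f df : R -> R) (u v : R) :
    (forall z : R, -1 <= z <= 1 -> is_derive z 1 f (df z)) ->
    -1 <= u -> u < v -> v <= 1 -> f v < f u -> exists c, [/\ u < c, c < v & df c < 0].
  move=> fd u1 uv v1; have [c [uc cv e]] := mvt _ _ _ _ fd u1 uv v1.
  by rewrite -subr_lt0 e pmulr_llt0 ?subr_gt0// => dfc; exists c.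
have GN1a : G (-1) < G a by rewrite GN1.
have Gaz : G z0 < G a := le_lt_trans Gz0 Ga.
have Gzb : G z0 < G b := le_lt_trans Gz0 Gb.
have Gb1 : G 1 < G b by rewrite G1E.
have az1 := lt_trans a1 a2; have bz1 := lt_trans b1 b2.
have aN1 := ltW a1; have zN1 := ltW az1; have bN1 := ltW (lt_trans az1 b1).
have z1 := ltW bz1; have b1' := ltW b2; have a1' := ltW (lt_trans a2 bz1).
(* Between -1, a, z0, b, 1 the function G rises, falls, rises and falls, so G' alternates in sign at
   c1 < c2 < c3 < c4. *)
have [c1 [c11 c12 d1]] := up _ _ _ _ dG (lexx _) a1 a1' GN1a.
have [c2 [c21 c22 d2]] := down _ _ _ _ dG aN1 a2 z1 Gaz.
have [c3 [c31 c32 d3]] := up _ _ _ _ dG zN1 b1 b1' Gzb.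
have [c4 [c41 c42 d4]] := down _ _ _ _ dG bN1 b2 (lexx _) Gb1.
have c12' := lt_trans c12 c21; have c23' := lt_trans c22 c31; have c34' := lt_trans c32 c41.
have c1N := ltW c11; have c4P := ltW c42.
have c2N := le_trans c1N (ltW c12'); have c3N := le_trans c2N (ltW c23').
have c3P := le_trans (ltW c34') c4P; have c2P := le_trans (ltW c23') c3P.
have [t1 [t11 t12 u1]] := down _ _ _ _ dG1 c1N c12' c2P (lt_trans d2 d1).
have [t2 [t21 t22 u2]] := up _ _ _ _ dG1 c2N c23' c3P (lt_trans d2 d3).
have [t3 [t31 t32 u3]] := down _ _ _ _ dG1 c3N c34' c4P (lt_trans d4 d3).
have := conc t1 t2 t3 (ltW (le_lt_trans c1N t11)) (lt_trans t12 t21)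
  (lt_trans t22 t31) (ltW (lt_le_trans t32 c4P)) u1 u3.
by rewrite leNgt u2.
Qed.

Lemma convex_quadratic_lt0 (A B C u v w : R) : 0 <= A -> u < v -> v < w ->
  A * u ^+ 2 + B * u + C < 0 -> A * w ^+ 2 + B * w + C < 0 ->
  A * v ^+ 2 + B * v + C < 0.
Proof.
move=> A0; rewrite -subr_gt0 => h2; rewrite -subr_gt0 => h1 qu qw.
have wu : 0 < w - u by rewrite -(subrK v w) -addrA addr_gt0.
rewrite -(pmulr_rlt0 _ wu).
(* The chord through u and w exceeds the quadratic at v by A (w - v) (v - u). *)
have -> : (w - u) * (A * v ^+ 2 + B * v + C) =
  (w - v) * (A * u ^+ 2 + B * u + C) + (v - u) * (A * w ^+ 2 + B * w + C)
  - (w - v) * (v - u) * (w - u) * A by ring.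
rewrite -(pmulr_rlt0 _ h1) in qu; rewrite -(pmulr_rlt0 _ h2) in qw.
have h3 : 0 <= (w - v) * (v - u) * (w - u) * A by rewrite !mulr_ge0// ltW.
by rewrite subr_lt0; apply: lt_le_trans h3; rewrite -[ltRHS]addr0 ltrD.
Qed.

Definition base_poly (x1 x2 : R) : {poly R} := (1 + x1 *: 'X) * (1 + x2 *: 'X).

Lemma base_polyE x1 x2 z : (base_poly x1 x2).[z] = (1 + x1 * z) * (1 + x2 * z).
Proof. by rewrite /base_poly !hornerE. Qed.

Lemma deriv_polyE n (a : nat -> R) :
  (\poly_(i < n.+1) a i)^`() = \poly_(i < n) (a i.+1 *+ i.+1).
Proof.
by apply/polyP => i; rewrite coef_deriv !coef_poly ltnS; case: ifP; rewrite ?mul0rn.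
Qed.

Lemma em_profile x1 x2 : 0 < x1 < 1 -> -1 < x2 < 0 ->
  exists (c S : R) (k H F : {poly R}),
  [/\ -1 < c < 1, H = base_poly x1 x2 + (1 - 'X^2) * k, F = (1 - 'X^2) * H,
      forall z, -1 <= z <= 1 -> 0 < H.[z] &
      forall z, (1 + c * z) ^+ 2 * F^`()^`().[z]
        - 10 * c * (1 + c * z) * F^`().[z] + 30 * c ^+ 2 * F.[z]
        = 4 * (x1 - x2) * (1 + c * z) ^+ 2 - S * (base_poly x1 x2).[z]].
Proof.
move=> hx1 hx2.
have [c [S [k0 [k1 [k2 [c_itv S_gt0 ode]]]]]] := em_coeffs_exist hx1 hx2.
move: ode; set al := nth 0 _ => ode.
pose F := \poly_(i < 7) al i.
pose k : {poly R} := k0%:P + k1 *: 'X + k2 *: 'X^2.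
pose H := base_poly x1 x2 + (1 - 'X^2) * k.
have odeF z : (1 + c * z) ^+ 2 * F^`()^`().[z]
        - 10 * c * (1 + c * z) * F^`().[z] + 30 * c ^+ 2 * F.[z]
        = 4 * (x1 - x2) * (1 + c * z) ^+ 2 - S * (base_poly x1 x2).[z].
  rewrite base_polyE -ode /F !deriv_polyE !horner_poly /=.
  congr (_ * _ - _ * _ + _); apply: eq_bigr => i _.
    by rewrite -mulrnA -[_ *+ (_ * _)]mulr_natl mulnC.
  by rewrite -[_ *+ _.+1]mulr_natl.
have FE : F = (1 - 'X^2) * H.
  rewrite /F poly_def !big_ord_recl big_ord0 /al /em_coeffs /= /H /k /base_poly.
  rewrite /bump /= -!mul_polyC !(polyCD, polyCN, polyCB, polyCM).
  by rewrite expr0 !addn0; ring.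
clearbody F.
exists c, S, k, H, F; split=> // z z_itv.
move: (c_itv) (z_itv) (hx1) (hx2)
  => /andP[c1 c2] /andP[z1 z2] /andP[x11 x12] /andP[x21 x22].
have Hend1 : 0 < H.[1].
  rewrite /H hornerD base_polyE !hornerE expr1n subrr mul0r addr0.
  by rewrite mulr_gt0; lra.
have HendN1 : 0 < H.[-1].
  rewrite /H hornerD base_polyE !hornerE sqrrN expr1n subrr mul0r addr0.
  by rewrite mulr_gt0; lra.
(* At the ends F vanishes and carries no information on H, but there H equals p. *)
have [->//|zN1] := eqVneq z (-1).
have [->//|zN2] := eqVneq z 1.
have z_oo : -1 < z < 1 by rewrite !lt_neqAle z1 z2 zN2 eq_sym zN1.
have f_gt0 (t : R) : -1 <= t <= 1 -> 0 < 1 + c * t.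
  exact: affine_gt0.
pose f : {poly R} := 1 + c *: 'X.
have fE t : f.[t] = 1 + c * t by rewrite /f !hornerE.
have df : f^`() = c%:P.
  by rewrite /f derivD derivZ derivX derivC add0r alg_polyC.
have f_neq0 n t : -1 <= t <= 1 -> (f ^+ n).[t] != 0.
  by move=> /f_gt0 h; rewrite horner_exp fE gt_eqF// exprn_gt0.
have Fsgn t : -1 < t < 1 -> (0 < F.[t] / (f ^+ 5).[t]) = (0 < H.[t]).
  move=> t_oo; have t_cc : -1 <= t <= 1 by case/andP: t_oo => *; rewrite !ltW.
  rewrite pmulr_lgt0; last first.
    by rewrite invr_gt0 horner_exp fE exprn_gt0// f_gt0.
  rewrite FE hornerM pmulr_rgt0// !hornerE; case/andP: t_oo => t1 t2; nra.
rewrite -Fsgn//.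
(* [N] / f^6 and [q] / f^7 are the first two derivatives of F / f^5. *)
pose N := F^`() * f - (5 * c) *: F.
pose q := F^`()^`() * f ^+ 2 - (10 * c) *: (F^`() * f) + (30 * c ^+ 2) *: F.
have qE t : q.[t] = 4 * (x1 - x2) * (1 + c * t) ^+ 2 - S * ((1 + x1 * t) * (1 + x2 * t)).
  rewrite -base_polyE -odeF /q !hornerE /=; ring.
have near_pos (e : R) : e = 1 \/ e = -1 -> \forall t \near e, 0 < H.[t].
  move=> he; have /cvgr_gt := @continuous_horner _ H e; apply.
  by case: he => ->.
apply: (@gt0_of_second_derivative (fun t => F.[t] / (f ^+ 5).[t])
   (fun t => N.[t] / (f ^+ 6).[t]) (fun t => q.[t] / (f ^+ 7).[t])) => //.
- move=> t t_cc; apply: is_derive_eq (is_derive_ratio F (f_neq0 5 _ t_cc)) _.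
  rewrite deriv_exp df /N !hornerE; have := f_gt0 _ t_cc.
  by rewrite /= => h; field; rewrite gt_eqF.
- move=> t t_cc; apply: is_derive_eq (is_derive_ratio N (f_neq0 6 _ t_cc)) _.
  rewrite /N deriv_exp derivB derivM derivZ df /q !hornerE.
  by have := f_gt0 _ t_cc; rewrite /= => h; field; rewrite gt_eqF.
- by rewrite FE !hornerE sqrrN expr1n subrr !mul0r.
- by rewrite FE !hornerE expr1n subrr !mul0r.
(* H is positive at the end, so F / f^5 is positive just inside; the bound (z + 1) / 2 keeps the
   point to the left of z. *)
- have /nbhs_ballP[e /= e0 he] := near_pos (-1) (or_intror erefl).
  pose d := Num.min (e / 2) ((z + 1) / 2).
  have d0 : 0 < d by rewrite lt_min !divr_gt0//; lra.
  have [de dz] : d <= e / 2 /\ d <= (z + 1) / 2 by rewrite !ge_min !lexx orbT.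
  exists (-1 + d); first by lra.
  rewrite Fsgn; last by lra.
  by apply: he; rewrite /ball /= opprD addrA subrr sub0r normrN gtr0_norm//; lra.
- have /nbhs_ballP[e /= e0 he] := near_pos 1 (or_introl erefl).
  pose d := Num.min (e / 2) ((1 - z) / 2).
  have d0 : 0 < d by rewrite lt_min !divr_gt0//; lra.
  have [de dz] : d <= e / 2 /\ d <= (1 - z) / 2 by rewrite !ge_min !lexx orbT.
  exists (1 - d); first by lra.
  rewrite Fsgn; last by lra.
  by apply: he; rewrite /ball /= opprD addrA subrr sub0r opprK gtr0_norm//; lra.
move=> u v w u1 uv vw w1.
have sgn t : -1 <= t <= 1 -> (q.[t] / (f ^+ 7).[t] < 0) = (q.[t] < 0).
  move=> /f_gt0 h.
  by rewrite pmulr_llt0// invr_gt0 horner_exp fE exprn_gt0.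
have [v1 uw1 vw1] : [/\ -1 <= v, u <= 1 & v <= 1].
  by have uv' := ltW uv; have vw' := ltW vw; split;
    rewrite ?(le_trans u1 uv') ?(le_trans (le_trans uv' vw') w1) ?(le_trans vw' w1).
have wN1 : -1 <= w := le_trans v1 (ltW vw).
rewrite !sgn ?u1 ?v1 ?wN1 ?uw1 ?vw1 ?w1//.
have quadE t : q.[t] = (4 * (x1 - x2) * c ^+ 2 + S * (x1 * - x2)) * t ^+ 2
    + (8 * (x1 - x2) * c - S * (x1 + x2)) * t + (4 * (x1 - x2) - S).
  by rewrite qE; ring.
move=> qu qw; apply/ltW; rewrite sgn ?v1 ?vw1//; move: qu qw; rewrite !quadE.
(* q is convex since S > 0 and x1 x2 < 0. *)
apply: convex_quadratic_lt0 => //.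
have x2N : 0 <= - x2 by rewrite oppr_ge0 ltW.
have x12N : 0 <= 4 * (x1 - x2) by rewrite mulr_ge0 ?addr_ge0 ?(ltW x11).
apply: addr_ge0; apply: mulr_ge0 => //; [exact: sqr_ge0|exact: ltW|].
by apply: mulr_ge0 => //; exact: ltW.
Qed.

End Profile.

(** * Curvature of Laurent polynomial metrics *)

Section DeriveComp.
Variables (R : realType) (V : normedModType R).
Implicit Types (f : R -> R) (g : V -> R) (x v : V) (a b : R).

(** Reduction to one variable: the chain rule below then needs only a directional derivative of g,
    not its differentiability. *)
Lemma is_derive_line g x v b :
  is_derive x v g b <-> is_derive (0 : R) 1 (fun h : R => g (h *: v + x)) b.
Proof.
have DE : 'D_1 (fun h : R => g (h *: v + x)) (0 : R) = 'D_v g x.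
  rewrite /derive; set f1 := fun h => h^-1 *: _; set f2 := fun h => h^-1 *: _.
  suff -> : f1 = f2 by []; apply/funext => h; rewrite /f1 /f2 /=.
  by rewrite addr0 scale0r add0r [_%:A]mulr1.
split=> -[dg <-]; apply: DeriveDef.
- exact: (proj1 (derivable1P g x v) dg).
- exact: DE.
- exact: (proj2 (derivable1P g x v) dg).
- exact: esym DE.
Qed.

Lemma is_derive_comp f g x v a b :
  is_derive (g x) 1 f a -> is_derive x v g b ->
  is_derive x v (fun y => f (g y)) (a * b).
Proof.
move=> fa /is_derive_line gb; apply/is_derive_line.
by apply: is_derive1_comp gb; rewrite scale0r add0r.
Qed.

End DeriveComp.

Lemma is_derive_coord (R : realType) n (k i : 'I_n.+1) (q : 'rV[R]_n.+1) :
  is_derive q (delta_mx 0 i : 'rV[R]_n.+1) (fun p => p 0 k) (k == i)%:R.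
Proof.
apply/is_derive_line.
have -> : (fun h : R => (h *: (delta_mx 0 i : 'rV[R]_n.+1) + q) 0 k)
        = (fun h => h * (k == i)%:R + q 0 k).
  by apply/funext => h; rewrite !mxE eqxx.
apply: is_derive_eq (is_derive_addf (is_derive_mulf (is_derive_id _ _)
  (is_derive_cst _ _ _)) (is_derive_cst _ _ _)) _.
by rewrite mulr0 !addr0 mul1r.
Qed.

(* A monomial is a coefficient, a list of exponents for variables [v] that may
   vanish, and a list of integer exponents for variables [w] that do not. *)
Definition lmono : Type := int * (seq nat * seq int).
Definition lpoly : Type := seq lmono.

(** * Arithmetic and differentiation of Laurent polynomials *)

Section LaurentOps.

Fixpoint zip_add T (op : T -> T -> T) (s t : seq T) : seq T :=
  match s, t with
  | [::], _ => t
  | _, [::] => s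
  | a :: s', b :: t' => op a b :: zip_add op s' t'
  end.

(** Missing exponents count as zero, so dropping trailing zeros gives each monomial a single
    representation, and like terms are found by comparing lists. *)
Definition trim (T : eqType) (z : T) (s : seq T) : seq T :=
  foldr (fun a r => if (a == z) && nilp r then [::] else a :: r) [::] s.

Definition lmono_mul (m1 m2 : lmono) : lmono :=
  (m1.1 * m2.1, (trim 0 (zip_add addn m1.2.1 m2.2.1),
                 trim 0 (zip_add +%R m1.2.2 m2.2.2))).

(** Since cancelled terms disappear, an identity is tested by reducing a difference to the empty
    list, and the terms need no order. *)
Fixpoint linsert (m : lmono) (P : lpoly) : lpoly :=
  if P isn't m' :: P' then [:: m] else
  if m.2 == m'.2 then
    if m.1 + m'.1 == 0 then P' else (m.1 + m'.1, m'.2) :: P'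
  else m' :: linsert m P'.

Definition ladd (P Q : lpoly) : lpoly := foldr linsert Q P.

Definition lscale (k : int) (P : lpoly) : lpoly :=
  [seq (k * m.1, m.2) | m <- P].

Definition lmul (P Q : lpoly) : lpoly :=
  foldr (fun m => ladd [seq lmono_mul m m' | m' <- Q]) [::] P.

Definition lsum (n : nat) (F : nat -> lpoly) : lpoly :=
  foldr (fun i => ladd (F i)) [::] (iota 0 n).

(* The derivative of [\prod_j x_j ^ s_j] is the sum of [k * x ^ t * x_j'] over
   the entries [(k, t, j)] of [diff_exps s]. *)
Fixpoint diff_exps T (isz : T -> bool) (int_of : T -> int)
    (dec : T -> T) (s : seq T) : seq (int * seq T * nat) :=
  if s isn't e :: s' then [::] else
  let r := [seq (x.1.1, e :: x.1.2, x.2.+1) | x <- diff_exps isz int_of dec s'] in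
  if isz e then r else (int_of e, dec e :: s', 0%N) :: r.

Definition lmono_diff (dv dw : nat -> lpoly) (m : lmono) : lpoly :=
  ladd
    (foldr (fun x => ladd (lmul [:: (m.1 * x.1.1, (trim 0 x.1.2, m.2.2))] (dv x.2))) [::]
       (diff_exps (fun e => e == 0%N) Posz predn m.2.1))
    (foldr (fun x => ladd (lmul [:: (m.1 * x.1.1, (m.2.1, trim 0 x.1.2))] (dw x.2))) [::]
       (diff_exps (fun e => e == 0) id (fun e => e - 1) m.2.2)).

Definition ldiff (dv dw : nat -> lpoly) (P : lpoly) : lpoly :=
  foldr (fun m => ladd (lmono_diff dv dw m)) [::] P.

End LaurentOps.

Section LaurentEval.
Variable R : realFieldType.
Implicit Types (v w : nat -> R) (m : lmono) (P Q : lpoly).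

Fixpoint monom_val T (pw : R -> T -> R) (x : nat -> R) (s : seq T) : R :=
  if s is e :: s' then pw (x 0%N) e * monom_val pw (fun i => x i.+1) s' else 1.

Definition lmono_eval v w m : R :=
  m.1%:~R * (monom_val (@GRing.exp R) v m.2.1 * monom_val (@exprz R) w m.2.2).

Definition leval v w P : R := \sum_(m <- P) lmono_eval v w m.

Lemma monom_val_zip_add T (z : T) op (pw : R -> T -> R) x s t :
  (forall i a b, pw (x i) (op a b) = pw (x i) a * pw (x i) b) ->
  monom_val pw x (zip_add op s t) = monom_val pw x s * monom_val pw x t.
Proof.
elim: s t x => [|a s IHs] [|b t] x pwD /=; rewrite ?mul1r ?mulr1//.
by rewrite pwD IHs; [ring|move=> i; exact: pwD].
Qed.

Lemma monom_val_trim (T : eqType) (z : T) (pw : R -> T -> R) x s :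
  (forall i, pw (x i) z = 1) -> monom_val pw x (trim z s) = monom_val pw x s.
Proof.
elim: s x => //= a s IHs x pw0.
have {}IHs := IHs _ (fun i => pw0 i.+1).
case: ifP => /= [/andP[/eqP -> /nilP ts]|_]; last by rewrite IHs.
by rewrite pw0 -IHs ts mulr1.
Qed.

Section Nonvanishing.
Variables (v w : nat -> R).
Hypothesis w_neq0 : forall i, w i != 0.
Local Notation "`[ P ]" := (leval v w P).

Lemma leval_nil : `[ [::] ] = 0. Proof. exact: big_nil. Qed.

Lemma leval_cons m P : `[ m :: P ] = lmono_eval v w m + `[P].
Proof. exact: big_cons. Qed.

Lemma lmono_eval_mul m1 m2 :
  lmono_eval v w (lmono_mul m1 m2) = lmono_eval v w m1 * lmono_eval v w m2.
Proof.
rewrite /lmono_eval /lmono_mul /= intrM !monom_val_trim//.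
rewrite (monom_val_zip_add 0%N) ?(monom_val_zip_add (0 : int)); first by ring.
  by move=> i a b; rewrite expfzDr.
by move=> i a b; rewrite exprD.
Qed.

Lemma leval_linsert m P : `[linsert m P] = lmono_eval v w m + `[P].
Proof.
elim: P => [|m' P IHP] /=; first exact: leval_cons.
case: eqP => [mm'|_]; last by rewrite !leval_cons IHP addrCA.
have mE : lmono_eval v w m + lmono_eval v w m' = lmono_eval v w (m.1 + m'.1, m'.2).
  by rewrite /lmono_eval /= mm' intrD mulrDl.
case: eqP => [m0|_]; rewrite !leval_cons addrA mE//.
by rewrite /lmono_eval /= m0 mul0r add0r.
Qed.

Lemma leval_add P Q : `[ladd P Q] = `[P] + `[Q].
Proof.
elim: P => [|m P IHP] /=; first by rewrite leval_nil add0r.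
by rewrite leval_linsert IHP leval_cons addrA.
Qed.

Lemma leval_scale k P : `[lscale k P] = k%:~R * `[P].
Proof.
rewrite /leval big_map mulr_sumr; apply: eq_bigr => m _.
by rewrite /lmono_eval /= intrM mulrA.
Qed.

Lemma leval_foldr T (F : T -> lpoly) (s : seq T) :
  `[foldr (fun x => ladd (F x)) [::] s] = \sum_(x <- s) `[F x].
Proof.
elim: s => [|x s IHs] /=; first by rewrite leval_nil big_nil.
by rewrite leval_add IHs big_cons.
Qed.

Lemma leval_mul P Q : `[lmul P Q] = `[P] * `[Q].
Proof.
rewrite leval_foldr mulr_suml; apply: eq_bigr => m _.
rewrite /leval big_map mulr_sumr; apply: eq_bigr => m' _.
exact: lmono_eval_mul.
Qed.

Lemma leval_sum n F : `[lsum n F] = \sum_(i < n) `[F i].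
Proof. by rewrite leval_foldr -(big_mkord xpredT (fun i => `[F i])) /index_iota subn0. Qed.

Lemma leval_mono1 m : `[ [:: m] ] = lmono_eval v w m.
Proof. by rewrite leval_cons leval_nil addr0. Qed.

End Nonvanishing.
End LaurentEval.

Section LaurentDerive.
Variables (R : realType) (V : normedModType R).
Implicit Types (x y : V) (v w : V -> nat -> R).

Lemma is_derive_exprz (f : V -> R) (e : int) x y a : f x != 0 ->
  is_derive x y f a ->
  is_derive x y (fun z => f z ^ e) (e%:~R * f x ^ (e - 1) * a).
Proof.
move=> fx0 fa; case: e => n.
  rewrite -[X in is_derive _ _ X _]/(fun z => f z ^+ n).
  apply: is_derive_eq (is_derive_expf n fa) _.
  case: n => [|n]; first by rewrite !mul0r.
  by rewrite intS addrAC subrr add0r.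
rewrite -[X in is_derive _ _ X _]/(fun z => (f z ^+ n.+1)^-1) NegzE.
have fn0 : f x ^+ n.+1 != 0 by rewrite expf_neq0.
apply: is_derive_eq (@is_derive_invf _ _ (fun z => f z ^+ n.+1) _ _ _ fn0
  (is_derive_expf n.+1 fa)) _.
have -> : - n.+1%:Z - 1 = - n.+2%:Z by rewrite -opprD [X in - X]addrC -intS.
rewrite -exprnN mulrNz -pmulrn /= !exprS.
have [fn0' f0] : f x ^+ n != 0 /\ f x != 0 by rewrite expf_neq0.
by field; rewrite f0 fn0'.
Qed.

(** The power is abstract to serve both natural and integer exponents. Skipping a zero exponent
    loses nothing, as its coefficient is 0. *)
Lemma is_derive_monom T (isz : T -> bool) (int_of : T -> int) (dec : T -> T)
    (pw : R -> T -> R)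
    (u : V -> nat -> R) (du : nat -> R) x y (s : seq T) :
  (forall i e, is_derive x y (fun p => pw (u p i) e)
     ((int_of e)%:~R * pw (u x i) (dec e) * du i)) ->
  (forall e, isz e -> int_of e = 0) ->
  is_derive x y (fun p => monom_val pw (u p) s)
    (\sum_(t <- diff_exps isz int_of dec s)
       t.1.1%:~R * monom_val pw (u x) t.1.2 * du t.2).
Proof.
move=> + iszP; elim: s u du => [|e s IHs] u du upw /=.
  rewrite big_nil; exact: is_derive_cst.
have {}IHs := IHs (fun p i => u p i.+1) (fun i => du i.+1) (fun i => upw i.+1).
apply: is_derive_eq (is_derive_mulf (upw 0%N e) IHs) _.
rewrite (_ : (if isz e then _ else _) = (if isz e then [::] else
   [:: (int_of e, dec e :: s, 0%N)]) ++
   [seq (t.1.1, e :: t.1.2, t.2.+1) | t <- diff_exps isz int_of dec s]);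
  last by case: ifP.
rewrite big_cat big_map mulr_sumr /=; congr (_ + _).
  case: ifP => [/iszP ->|_]; first by rewrite big_nil !mul0r.
  by rewrite big_seq1 /=; ring.
by apply: eq_bigr => t _; ring.
Qed.

Variables (v w : V -> nat -> R) (x y : V) (dv dw : nat -> lpoly).
Hypothesis w_neq0 : forall i, w x i != 0.
Local Notation "`[ P ]" := (leval (v x) (w x) P).
Hypothesis v_derive : forall i, is_derive x y (fun p => v p i) `[dv i].
Hypothesis w_derive : forall i, is_derive x y (fun p => w p i) `[dw i].

Lemma is_derive_lmono m :
  is_derive x y (fun p => lmono_eval (v p) (w p) m) `[lmono_diff dv dw m].
Proof.
have dn := @is_derive_monom _ (fun e => e == 0%N) Posz predn (@GRing.exp R)
  v _ x y m.2.1 (fun i e => is_derive_expf e (v_derive i)).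
have dz := @is_derive_monom _ (fun e => e == 0) id (fun e => e - 1) (@exprz R)
  w _ x y m.2.2 (fun i e => is_derive_exprz e (w_neq0 i) (w_derive i)).
have := is_derive_mulf (is_derive_cst (m.1%:~R : R) x y)
          (is_derive_mulf (dn _) (dz _)).
move=> /(_ (fun e => _) (fun e => _)) h.
apply: is_derive_eq (h _ _) _.
- by move=> e /eqP ->.
- by move=> e /eqP ->.
rewrite mul0r add0r leval_add !leval_foldr mulrDr; congr (_ + _).
  rewrite mulr_suml mulr_sumr; apply: eq_bigr => t _.
  rewrite leval_mul// leval_mono1 /lmono_eval /= intrM monom_val_trim//.
  by ring.
rewrite !mulr_sumr; apply: eq_bigr => t _.
rewrite leval_mul// leval_mono1 /lmono_eval /= intrM monom_val_trim//.
by ring.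
Qed.

Lemma is_derive_leval P :
  is_derive x y (fun p => leval (v p) (w p) P) `[ldiff dv dw P].
Proof.
elim: P => [|m P IHP].
  under [X in is_derive _ _ X _]eq_fun do rewrite leval_nil.
  by rewrite leval_nil; exact: is_derive_cst.
under [X in is_derive _ _ X _]eq_fun do rewrite leval_cons.
by rewrite leval_add; apply: is_derive_addf; first exact: is_derive_lmono.
Qed.

End LaurentDerive.

(** Natural numbers as indices let the test be evaluated; the result is transferred to ordinals
    afterwards. *)
Definition check2 n (P : nat -> nat -> bool) : bool :=
  all (fun i => all (P i) (iota 0 n)) (iota 0 n).

Lemma check2P n (P : nat -> nat -> bool) : check2 n P -> forall i j : 'I_n, P i j.
Proof.
move=> /allP chk i j; have /chk /allP : nat_of_ord i \in iota 0 n.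
  by rewrite mem_iota ltn_ord.
by apply; rewrite mem_iota ltn_ord.
Qed.

(** * Symbolic Christoffel symbols, Ricci and scalar curvature *)

Section CurvatureOps.
Variables (n : nat) (dv dw : nat -> nat -> lpoly).
Implicit Types (G Gi : nat -> nat -> lpoly) (C : nat -> nat -> nat -> lpoly).

(** Each entry is computed once and then looked up, since the curvature uses it many times. *)
Definition tabulate2 (F : nat -> nat -> lpoly) : nat -> nat -> lpoly :=
  let t := [seq [seq F i j | j <- iota 0 n] | i <- iota 0 n] in
  fun i j => nth [::] (nth [::] t i) j.

Definition tabulate3 (F : nat -> nat -> nat -> lpoly) : nat -> nat -> nat -> lpoly :=
  let t := [seq [seq [seq F k i j | j <- iota 0 n] | i <- iota 0 n] | k <- iota 0 n] in
  fun k i j => nth [::] (nth [::] (nth [::] t k) i) j.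

Definition lproduct G Gi i j : lpoly := lsum n (fun k => lmul (G i k) (Gi k j)).

(** Twice the Christoffel symbol; with four times the Ricci and scalar curvature below, this clears
    the halves and keeps coefficients integral. *)
Definition lchristoffel2 G Gi k i j : lpoly :=
  lsum n (fun l => lmul (Gi k l)
    (ladd (ldiff (dv i) (dw i) (G j l))
       (ladd (ldiff (dv j) (dw j) (G i l))
             (lscale (-1) (ldiff (dv l) (dw l) (G i j)))))).

Definition lricci4 C i j : lpoly :=
  lsum n (fun k =>
    ladd (ladd (lscale 2 (ldiff (dv k) (dw k) (C k i j)))
               (lscale (-2) (ldiff (dv j) (dw j) (C k i k))))
         (lsum n (fun l => ladd (lmul (C k k l) (C l i j))
                                (lscale (-1) (lmul (C k j l) (C l i k)))))).

Definition lscalar4 G Gi : lpoly :=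
  let C := tabulate3 (lchristoffel2 G Gi) in
  lsum n (fun i => lsum n (fun j => lmul (Gi i j) (lricci4 C i j))).

Lemma tabulate2E F i j : (i < n)%N -> (j < n)%N -> tabulate2 F i j = F i j.
Proof.
by move=> iN jN; rewrite /tabulate2 !(nth_map 0%N) ?size_iota// !nth_iota.
Qed.

Lemma tabulate3E F k i j : (k < n)%N -> (i < n)%N -> (j < n)%N ->
  tabulate3 F k i j = F k i j.
Proof.
by move=> kN iN jN; rewrite /tabulate3 !(nth_map 0%N) ?size_iota// !nth_iota.
Qed.

End CurvatureOps.

Section LaurentMetric.
Variables (R : realType) (n : nat).
Local Notation E := 'rV[R]_n.+1.
Variables (U : set E) (v w : E -> nat -> R) (dv dw : nat -> nat -> lpoly).
Hypothesis U_open : open U.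
Hypothesis w_neq0 : forall q, U q -> forall i, w q i != 0.
Local Notation "`[ P ]_ q" := (leval (v q) (w q) P)
  (at level 0, P at level 99, q at level 2).
Hypothesis v_derive : forall (i : 'I_n.+1) q, U q -> forall j,
  is_derive q (delta_mx 0 i : E) (fun p => v p j) `[dv i j]_q.
Hypothesis w_derive : forall (i : 'I_n.+1) q, U q -> forall j,
  is_derive q (delta_mx 0 i : E) (fun p => w p j) `[dw i j]_q.

Lemma eq_on_partial (f g : E -> R) (i : 'I_n.+1) q : U q ->
  (forall p, U p -> f p = g p) -> partial i f q = partial i g q.
Proof.
move=> Uq fg; apply: near_eq_derive.
by apply: filterS (open_nbhs_nbhs (conj U_open Uq)) => p; exact: fg.
Qed.

Lemma partial_leval (f : E -> R) P (i : 'I_n.+1) q : U q ->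
  (forall p, U p -> f p = `[P]_p) ->
  partial i f q = `[ldiff (dv i) (dw i) P]_q.
Proof.
move=> Uq fP; rewrite (eq_on_partial i Uq fP).
by have [_ <-] := is_derive_leval (w_neq0 Uq) (v_derive i Uq) (w_derive i Uq) P.
Qed.

Variables (g : E -> 'M[R]_n.+1) (G Gi : nat -> nat -> lpoly).
Hypothesis gE : forall q, U q -> forall i j : 'I_n.+1, g q i j = `[G i j]_q.

Lemma leval_lproduct (A B : 'M[R]_n.+1) (LA LB : nat -> nat -> lpoly) q : U q ->
  (forall i j : 'I_n.+1, A i j = `[LA i j]_q) ->
  (forall i j : 'I_n.+1, B i j = `[LB i j]_q) ->
  forall i j, (A *m B) i j = `[lproduct n.+1 LA LB i j]_q.
Proof.
move=> Uq AE BE i j; rewrite mxE /lproduct leval_sum.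
by apply: eq_bigr => k _; rewrite leval_mul ?AE ?BE//; exact: w_neq0.
Qed.

(** A candidate inverse is verified by multiplication, so no determinant is ever expanded. *)
Lemma metric_inverse q : U q ->
  (forall i j : 'I_n.+1,
     lproduct n.+1 G Gi i j = if i == j then [:: (1, ([::], [::]))] else [::]) ->
  g q \in unitmx /\ (forall i j : 'I_n.+1, invmx (g q) i j = `[Gi i j]_q).
Proof.
move=> Uq GGi; pose B := \matrix_(i, j < n.+1) `[Gi i j]_q.
have gB : g q *m B = 1%:M.
  apply/matrixP => i j; rewrite (leval_lproduct Uq (gE Uq) (LB := Gi)).
    rewrite GGi mxE; case: (i == j); last exact: leval_nil.
    by rewrite leval_cons leval_nil /lmono_eval /= !mulr1 addr0.
  by move=> k l; rewrite mxE.
have [gu _] := mulmx1_unit gB; split=> // i j.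
have -> : invmx (g q) = B.
  by rewrite -[B]mul1mx -(mulVmx gu) -mulmxA gB mulmx1.
by rewrite mxE.
Qed.

Hypothesis giE : forall q, U q -> forall i j : 'I_n.+1,
  invmx (g q) i j = `[Gi i j]_q.

Lemma christoffel_leval (k i j : 'I_n.+1) q : U q ->
  2 * christoffel g k i j q = `[lchristoffel2 n.+1 dv dw G Gi k i j]_q.
Proof.
move=> Uq; rewrite mulrA divff ?pnatr_eq0// mul1r leval_sum.
have dg (a b c : 'I_n.+1) :
    partial a (fun p => g p b c) q = `[ldiff (dv a) (dw a) (G b c)]_q.
  by apply: partial_leval => // p Up; exact: gE.
apply: eq_bigr => l _; have wq := w_neq0 Uq.
rewrite leval_mul// !leval_add// leval_scale giE// !mulN1r.
by rewrite !dg addrA.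
Qed.

Lemma ricci_leval (C : nat -> nat -> nat -> lpoly) (i j : 'I_n.+1) q : U q ->
  (forall k i j : 'I_n.+1, C k i j = lchristoffel2 n.+1 dv dw G Gi k i j) ->
  4 * ricci g i j q = `[lricci4 n.+1 dv dw C i j]_q.
Proof.
move=> Uq CE; have wq := w_neq0 Uq.
have half (k a b : 'I_n.+1) p : U p ->
    christoffel g k a b p = 2^-1 * `[C k a b]_p.
  by move=> Up; rewrite CE -christoffel_leval// mulKf ?pnatr_eq0.
have dhalf (l k a b : 'I_n.+1) :
    partial l (christoffel g k a b) q = 2^-1 * `[ldiff (dv l) (dw l) (C k a b)]_q.
  rewrite (eq_on_partial l Uq (half k a b)).
  have dC := is_derive_leval (w_neq0 Uq) (v_derive l Uq) (w_derive l Uq) (C k a b).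
  have [_ dE] := is_derive_mulf (is_derive_cst (2^-1 : R) q (delta_mx 0 l : E)) dC.
  by apply: (etrans dE); rewrite mul0r add0r.
rewrite /ricci leval_sum -big_split mulr_sumr; apply: eq_bigr => k _.
rewrite leval_add// leval_sum mulrDr; congr (_ + _).
  by rewrite leval_add// !leval_scale !dhalf; field.
rewrite mulr_sumr; apply: eq_bigr => l _.
by rewrite leval_add// leval_scale !leval_mul// !half//; field.
Qed.

Lemma scalar_curvature_leval q : U q ->
  4 * scalar_curvature g q = `[lscalar4 n.+1 dv dw G Gi]_q.
Proof.
move=> Uq; have wq := w_neq0 Uq; rewrite /lscalar4.
set C := tabulate3 _ _.
have CE (k i j : 'I_n.+1) : C k i j = lchristoffel2 n.+1 dv dw G Gi k i j.
  by rewrite /C tabulate3E.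
rewrite leval_sum mulr_sumr; apply: eq_bigr => i _.
rewrite leval_sum mulr_sumr; apply: eq_bigr => j _.
by rewrite leval_mul// -(ricci_leval _ _ Uq CE) giE// mulrCA.
Qed.

End LaurentMetric.

(** * Admissible metrics *)

(* v = (x1, y1, x2, y2, c, F', F'', ...) and
   w = (u1, u2, 1 + x1 z, 1 + x2 z, 1 + c z, F, x1 / 2, x2 / 2, s) with
   ui = 1 / (1 + |wi|^2): in these variables the metric (1 + c z)^e g, its
   inverse, its complex structure and its Kaehler form are Laurent polynomials
   with integer coefficients. *)
Definition lmon (k : int) (s : seq nat) (t : seq int) : lpoly := [:: (k, (s, t))].

(** In the direction z the variable of index j > 4, a derivative of F, passes to the next one; the
    infinite supply of variables makes the family closed. *)
Definition adm_dv (i j : nat) : lpoly :=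
  if (i < 4)%N then if i == j then lmon 1 [::] [::] else [::]
  else if (i == 4)%N && (4 < j)%N then lmon 1 (rcons (nseq j.+1 0%N) 1%N) [::]
  else [::].

(** The variables x1 / 2 and x2 / 2 absorb the factor 2 of the Fubini-Study metric, whose inverse
    would otherwise have a coefficient 1/2. *)
Definition adm_dw (i j : nat) : lpoly :=
  match i, j with
  | 0, 0 => lmon (-2) [:: 1]%N [:: 2]
  | 1, 0 => lmon (-2) [:: 0; 1]%N [:: 2]
  | 2, 1 => lmon (-2) [:: 0; 0; 1]%N [:: 0; 2]
  | 3, 1 => lmon (-2) [:: 0; 0; 0; 1]%N [:: 0; 2]
  | 4, 2 => lmon 2 [::] [:: 0; 0; 0; 0; 0; 0; 1]
  | 4, 3 => lmon 2 [::] [:: 0; 0; 0; 0; 0; 0; 0; 1]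
  | 4, 4 => lmon 1 [:: 0; 0; 0; 0; 1]%N [::]
  | 4, 5 => lmon 1 [:: 0; 0; 0; 0; 0; 1]%N [::]
  | _, _ => [::]
  end.

Definition adm_theta (i : nat) : lpoly :=
  nth [::] [:: lmon (-1) [:: 0; 1]%N [:: 1]; lmon 1 [:: 1]%N [:: 1];
               lmon 1 [:: 0; 0; 0; 1]%N [:: 0; 1]; lmon (-1) [:: 0; 0; 1]%N [:: 0; 1];
               [::]; lmon 1 [::] [::]] i.

Definition adm_diag (e : int) (i : nat) : lpoly :=
  let A := lmon 1 [::] [:: 2; 0; 1; 0; e; 0; -1; 0; 1] in
  let B := lmon (-1) [::] [:: 0; 2; 0; 1; e; 0; 0; -1; 1] in
  nth [::] [:: A; A; B; B; lmon 1 [::] [:: 0; 0; 1; 1; e; -1; 0; 0; 1]] i.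

Definition adm_diag_inv (e : int) (i : nat) : lpoly :=
  let A := lmon 1 [::] [:: -2; 0; -1; 0; - e; 0; 1; 0; -1] in
  let B := lmon (-1) [::] [:: 0; -2; 0; -1; - e; 0; 0; 1; -1] in
  nth [::] [:: A; A; B; B; lmon 1 [::] [:: 0; 0; -1; -1; - e; 1; 0; 0; -1]] i.

Definition adm_metric (e : int) : nat -> nat -> lpoly := tabulate2 6 (fun i j =>
  ladd (if i == j then adm_diag e i else [::])
    (lmul (lmon 1 [::] [:: 0; 0; -1; -1; e; 1; 0; 0; 1])
       (lmul (adm_theta i) (adm_theta j)))).

(** The inverse metric is diagonal in the vectors d/dx_i - theta_i d/dt and d/dt dual to dx_i and
    theta; these are its entries in the coordinate basis. The sum stops at 4 because theta has no dz
    component. *)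
Definition adm_metric_inv (e : int) : nat -> nat -> lpoly := tabulate2 6 (fun i j =>
  if i == 5%N then
    if j == 5%N then
      ladd (lmon 1 [::] [:: 0; 0; 1; 1; - e; -1; 0; 0; -1])
        (lsum 4 (fun k => lmul (adm_diag_inv e k) (lmul (adm_theta k) (adm_theta k))))
    else lscale (-1) (lmul (adm_diag_inv e j) (adm_theta j))
  else if j == 5%N then lscale (-1) (lmul (adm_diag_inv e i) (adm_theta i))
  else if i == j then adm_diag_inv e i else [::]).

Definition ldelta (i k : nat) : lpoly := if i == k then lmon 1 [::] [::] else [::].

Definition adm_lift (k j : nat) : lpoly :=
  ladd (ldelta j k) (lscale (-1) (lmul (adm_theta k) (ldelta j 5))).

Definition adm_J (i j : nat) : lpoly :=
  ladd (ladd (ladd (ladd (ladd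
    (lmul (ldelta i 0) (adm_lift 1 j))
    (lscale (-1) (lmul (ldelta i 1) (adm_lift 0 j))))
    (lmul (ldelta i 2) (adm_lift 3 j)))
    (lscale (-1) (lmul (ldelta i 3) (adm_lift 2 j))))
    (lmul (lmon 1 [::] [:: 0; 0; 1; 1; 0; -1]) (lmul (ldelta i 4) (ldelta j 5))))
    (lscale (-1) (lmul (lmon 1 [::] [:: 0; 0; -1; -1; 0; 1])
                       (lmul (adm_theta i) (ldelta j 4)))).

Definition adm_form (i j : nat) : lpoly :=
  ladd (ladd (ladd
    (lmul (adm_diag 0 0) (ladd (lmul (ldelta i 0) (ldelta j 1))
                               (lscale (-1) (lmul (ldelta i 1) (ldelta j 0)))))
    (lmul (adm_diag 0 2) (ladd (lmul (ldelta i 2) (ldelta j 3))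
                               (lscale (-1) (lmul (ldelta i 3) (ldelta j 2))))))
    (lmul (lmon 1 [::] [:: 0; 0; 0; 0; 0; 0; 0; 0; 1]) (lmul (ldelta i 4) (adm_theta j))))
    (lscale (-1) (lmul (lmon 1 [::] [:: 0; 0; 0; 0; 0; 0; 0; 0; 1])
                       (lmul (adm_theta i) (ldelta j 4)))).

(* ui^-1 - 1 - |wi|^2, which vanishes; the scalar curvature of (1 + c z)^-2 g,
   computed with independent variables, is reduced modulo these relations. *)
Definition adm_rel1 : lpoly :=
  [:: (1, ([::], [:: -1])); (-1, ([::], [::]));
      (-1, ([:: 2]%N, [::])); (-1, ([:: 0; 2]%N, [::]))].
Definition adm_rel2 : lpoly :=
  [:: (1, ([::], [:: 0; -1])); (-1, ([::], [::]));
      (-1, ([:: 0; 0; 2]%N, [::])); (-1, ([:: 0; 0; 0; 2]%N, [::]))].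

(** With u1 independent of the coordinates, the Gaussian curvature of the first factor carries 1 +
    rel1, and the norm of d theta carries (1 + rel1)^2 = 1 + rel1 (rel1 + 2). The two summands are
    the resulting multiples of rel1. *)
Definition adm_cofactor1 : lpoly := ladd
  (lmon 32 [::] [:: 0; 0; -1; 0; 2; 0; 1; 0; -1])
  (lmul (lmon (-8) [::] [:: 0; 0; -3; -1; 2; 1; 2; 0; -1])
        (ladd adm_rel1 (lmon 2 [::] [::]))).
Definition adm_cofactor2 : lpoly := ladd
  (lmon (-32) [::] [:: 0; 0; 0; -1; 2; 0; 0; 1; -1])
  (lmul (lmon (-8) [::] [:: 0; 0; -1; -3; 2; 1; 0; 2; -1])
        (ladd adm_rel2 (lmon 2 [::] [::]))).

(** Times p s / 4, this is 4 (x1 - x2) f^2 minus the differential operator applied to F, since x1 (1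
    + x2 z) - x2 (1 + x1 z) = x1 - x2. *)
Definition adm_scalar4 : lpoly :=
  [:: (32, ([::], [:: 0; 0; -1; 0; 2; 0; 1; 0; -1]));
      (-32, ([::], [:: 0; 0; 0; -1; 2; 0; 0; 1; -1]));
      (-120, ([:: 0; 0; 0; 0; 2]%N, [:: 0; 0; -1; -1; 0; 1; 0; 0; -1]));
      (40, ([:: 0; 0; 0; 0; 1; 1]%N, [:: 0; 0; -1; -1; 1; 0; 0; 0; -1]));
      (-4, ([:: 0; 0; 0; 0; 0; 0; 1]%N, [:: 0; 0; -1; -1; 2; 0; 0; 0; -1]))].

Lemma adm_scalar4_check :
  ladd (lscalar4 6 adm_dv adm_dw (adm_metric (-2)) (adm_metric_inv (-2)))
    (lscale (-1) (ladd adm_scalar4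
       (ladd (lmul adm_cofactor1 adm_rel1) (lmul adm_cofactor2 adm_rel2)))) = [::].
Proof. by vm_compute. Qed.

Lemma adm_form_check : check2 6 (fun i j =>
  ladd (lproduct 6 adm_J (adm_metric 0) i j) (lscale (-1) (adm_form i j)) == [::]).
Proof. by vm_compute. Qed.

Lemma adm_killing_check : check2 6 (fun i j =>
  ldiff (adm_dv 5) (adm_dw 5) (adm_metric 0 i j) == [::]).
Proof. by vm_compute. Qed.

Lemma adm_inverse_check e : e \in [:: 0 : int; -2] ->
  check2 6 (fun i j => lproduct 6 (adm_metric e) (adm_metric_inv e) i j
     == if i == j then [:: (1, ([::], [::]))] else [::]).
Proof. by rewrite !inE => /orP[] /eqP ->; vm_compute. Qed.

(** * The symbolic tensors evaluate to the admissible structure *)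

Section AdmissibleGeometry.
Variables (R : realType) (s x1 x2 c S : R) (F : {poly R}).
Local Notation E := 'rV[R]_6.
Hypotheses (s_gt0 : 0 < s) (x1_itv : 0 < x1 < 1) (x2_itv : -1 < x2 < 0).
Hypotheses (c_itv : -1 < c < 1) (F_gt0 : forall z, -1 < z < 1 -> 0 < F.[z]).
Hypothesis F_ode : forall z, (1 + c * z) ^+ 2 * F^`()^`().[z]
  - 10 * c * (1 + c * z) * F^`().[z] + 30 * c ^+ 2 * F.[z]
  = 4 * (x1 - x2) * (1 + c * z) ^+ 2 - S * ((1 + x1 * z) * (1 + x2 * z)).

Definition Theta_of (z : R) : R := F.[z] / ((1 + x1 * z) * (1 + x2 * z)).

Definition adm_v (q : E) (j : nat) : R :=
  match j with
  | 0 => q 0 0 | 1 => q 0 1 | 2 => q 0 2 | 3 => q 0 3 | 4 => c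
  | j'.+4.+1 => (F^`(j'.+1)).[q 0 4]
  end.

(** The value 1 past index 8 keeps every variable with integer exponents nonzero. *)
Definition adm_w (q : E) (j : nat) : R :=
  match j with
  | 0 => (1 + normsq 0 1 q)^-1 | 1 => (1 + normsq 2 3 q)^-1
  | 2 => 1 + x1 * q 0 4 | 3 => 1 + x2 * q 0 4 | 4 => 1 + c * q 0 4
  | 5 => F.[q 0 4] | 6 => x1 / 2 | 7 => x2 / 2 | 8 => s | _ => 1
  end.

Local Notation U := (@momentum_domain R).
Local Notation "`[ P ]_ q" := (leval (adm_v q) (adm_w q) P)
  (at level 0, P at level 99, q at level 2).

Lemma momentum_domain_open : open U.
Proof.
have -> : U = (fun p : E => p 0 4) @^-1` [set` `]-1, (1 : R)[].
  by apply/seteqP; split=> p /=; rewrite in_itv.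
apply: open_comp; last exact: interval_open.
by move=> p _; exact: coord_continuous.
Qed.

Lemma normsq1_neq0 (i j : 'I_6) (q : E) : 1 + normsq i j q != 0.
Proof. by rewrite gt_eqF// ltr_pwDl// addr_ge0 ?sqr_ge0. Qed.

Lemma adm_w_neq0 q : U q -> forall j, adm_w q j != 0.
Proof.
rewrite /momentum_domain /= => zq.
have zq' : -1 <= q 0 4 <= 1 by case/andP: zq => *; rewrite !ltW.
case/andP: (x1_itv) => x10 x11; case/andP: (x2_itv) => x20 x21.
do 9?[case] => /=; last by move=> _; rewrite oner_eq0.
- by rewrite invr_eq0 normsq1_neq0.
- by rewrite invr_eq0 normsq1_neq0.
- by rewrite gt_eqF// affine_gt0//; lra.
- by rewrite gt_eqF// affine_gt0//; lra.
- by rewrite gt_eqF// affine_gt0//; lra.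
- by rewrite gt_eqF// F_gt0.
- by rewrite gt_eqF//; lra.
- by rewrite lt_eqF//; lra.
- by rewrite gt_eqF.
Qed.

Lemma eq_ord_nat (i j : 'I_6) : (i == j) = (i == j :> nat). Proof. by []. Qed.

Lemma leval_lmon k sv sw q :
  `[lmon k sv sw]_q = k%:~R * (monom_val (@GRing.exp R) (adm_v q) sv
                              * monom_val (@exprz R) (adm_w q) sw).
Proof. exact: leval_mono1. Qed.

Lemma is_derive_horner_coord (p : {poly R}) (i : 'I_6) (q : E) :
  is_derive q (delta_mx 0 i : E) (fun q => p.[q 0 4]) (p^`().[q 0 4] * (i == 4)%:R).
Proof.
rewrite [i == 4]eq_sym.
apply: (@is_derive_comp _ _ (horner p) (fun q : E => q 0 4)).
exact: is_derive_coord.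
Qed.

Lemma adm_v_derive (i : 'I_6) q : U q -> forall j,
  is_derive q (delta_mx 0 i : E) (fun p => adm_v p j) `[adm_dv i j]_q.
Proof.
move=> Uq j.
have co (k : 'I_6) : is_derive q (delta_mx 0 i : E) (fun p : E => p 0 k) (k == i)%:R.
  exact: is_derive_coord.
have one : `[lmon 1 [::] [::]]_q = 1 by rewrite leval_lmon /= !mulr1.
move: j => [|[|[|[|[|j]]]]] /=.
- apply: is_derive_eq (co 0) _.
  by case: i {co} => -[|[|[|[|[|[|//]]]]]] ? /=; rewrite ?one ?leval_nil.
- apply: is_derive_eq (co 1) _.
  by case: i {co} => -[|[|[|[|[|[|//]]]]]] ? /=; rewrite ?one ?leval_nil.
- apply: is_derive_eq (co 2) _.
  by case: i {co} => -[|[|[|[|[|[|//]]]]]] ? /=; rewrite ?one ?leval_nil.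
- apply: is_derive_eq (co 3) _.
  by case: i {co} => -[|[|[|[|[|[|//]]]]]] ? /=; rewrite ?one ?leval_nil.
- apply: is_derive_eq (is_derive_cst _ _ _) _.
  by case: i {co} => -[|[|[|[|[|[|//]]]]]] ? /=; rewrite ?one ?leval_nil.
apply: is_derive_eq (is_derive_horner_coord _ _ _) _.
rewrite -derivnS /adm_dv.
case: i {co} => -[|[|[|[|[|[|//]]]]]] h; rewrite /= ?leval_nil ?mulr0//.
rewrite mulr1 leval_lmon mulr1 mul1r /=.
have E k (y : nat -> R) : monom_val (@GRing.exp R) y (rcons (nseq k 0%N) 1%N) = y k.
  by elim: k y => [|k IHk] y /=; rewrite ?expr1 ?mulr1// expr0 mul1r IHk.
by rewrite E /= !mul1r.
Qed.

Lemma adm_w_derive (i : 'I_6) q : U q -> forall j,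
  is_derive q (delta_mx 0 i : E) (fun p => adm_w p j) `[adm_dw i j]_q.
Proof.
move=> Uq j.
have co (k : 'I_6) : is_derive q (delta_mx 0 i : E) (fun p : E => p 0 k) (k == i)%:R.
  exact: is_derive_coord.
have nsq (a b : 'I_6) : is_derive q (delta_mx 0 i : E) (fun p => (1 + normsq a b p)^-1)
    (- 2 * (q 0 a * (a == i)%:R + q 0 b * (b == i)%:R) * (1 + normsq a b q)^-1 ^+ 2).
  apply: is_derive_eq (@is_derive_invf _ _ (fun p => 1 + normsq a b p) _ _ _
    (normsq1_neq0 a b q)
    (is_derive_addf (is_derive_cst _ _ _) (is_derive_addf
      (is_derive_expf 2 (co a)) (is_derive_expf 2 (co b))))) _.
  by have := normsq1_neq0 a b q; rewrite /= => h; field.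
have aff (t : R) : is_derive q (delta_mx 0 i : E)
    (fun p : E => 1 + t * p 0 4) (t * (i == 4)%:R).
  rewrite [i == 4]eq_sym; apply: is_derive_eq (is_derive_addf (is_derive_cst _ _ _)
    (is_derive_mulf (is_derive_cst _ _ _) (co 4))) _.
  by rewrite mul0r !add0r.
have cs (t : R) : is_derive q (delta_mx 0 i : E) (fun _ : E => t) 0 by exact: is_derive_cst.
move: j => [|[|[|[|[|[|[|[|[|j]]]]]]]]] /=.
- apply: is_derive_eq (nsq 0 1) _.
  case: i {co nsq aff cs} => -[|[|[|[|[|[|//]]]]]] h;
    rewrite /= ?leval_nil ?leval_lmon /= -?exprnP;
    ring.
- apply: is_derive_eq (nsq 2 3) _.
  case: i {co nsq aff cs} => -[|[|[|[|[|[|//]]]]]] h;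
    rewrite /= ?leval_nil ?leval_lmon /= -?exprnP;
    ring.
- apply: is_derive_eq (aff x1) _.
  case: i {co nsq aff cs} => -[|[|[|[|[|[|//]]]]]] h;
    rewrite /= ?leval_nil ?leval_lmon /= -?exprnP ?expr0 ?expr1 ?mul1r ?mulr1;
    by field.
- apply: is_derive_eq (aff x2) _.
  case: i {co nsq aff cs} => -[|[|[|[|[|[|//]]]]]] h;
    rewrite /= ?leval_nil ?leval_lmon /= -?exprnP ?expr0 ?expr1 ?mul1r ?mulr1;
    by field.
- apply: is_derive_eq (aff c) _.
  case: i {co nsq aff cs} => -[|[|[|[|[|[|//]]]]]] h;
    rewrite /= ?leval_nil ?leval_lmon /= -?exprnP ?expr0 ?expr1 ?mul1r ?mulr1;
    by field.
- apply: is_derive_eq (is_derive_horner_coord _ _ _) _.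
  case: i {co nsq aff cs} => -[|[|[|[|[|[|//]]]]]] h;
    rewrite /= ?leval_nil ?leval_lmon /= -?exprnP ?derivn1 ?expr0 ?expr1 ?mul1r ?mulr1;
    by field.
- apply: is_derive_eq (cs _) _.
  by case: i {co nsq aff cs} => -[|[|[|[|[|[|//]]]]]] h; rewrite /= leval_nil.
- apply: is_derive_eq (cs _) _.
  by case: i {co nsq aff cs} => -[|[|[|[|[|[|//]]]]]] h; rewrite /= leval_nil.
- apply: is_derive_eq (cs _) _.
  by case: i {co nsq aff cs} => -[|[|[|[|[|[|//]]]]]] h; rewrite /= leval_nil.
apply: is_derive_eq (cs _) _.
by case: i {co nsq aff cs} => -[|[|[|[|[|[|//]]]]]] h; rewrite /= leval_nil.
Qed.


Lemma sqformE n (a : 'rV[R]_n.+1) i j : sqform a i j = a 0 i * a 0 j.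
Proof. by rewrite /sqform mxE big_ord1 mxE. Qed.

Lemma wedgeE n (a b : 'rV[R]_n.+1) i j :
  wedge a b i j = a 0 i * b 0 j - b 0 i * a 0 j.
Proof. by rewrite /wedge !mxE !big_ord1 !mxE. Qed.

Lemma dxE (k i : 'I_6) : (dx k : E) 0 i = (i == k)%:R.
Proof. by rewrite /dx mxE eqxx. Qed.

Lemma thetaE p (i : 'I_6) : theta p 0 i = `[adm_theta i]_p.
Proof.
rewrite /theta /fs_connection !mxE.
case: i => -[|[|[|[|[|[|//]]]]]] h; rewrite /adm_theta /= ?leval_nil ?leval_lmon /=.
all: rewrite -?exprnP ?expr0 ?expr1 ?mul1r ?mulr1 ?(mulr1z, mulrN1z).
all: rewrite ?mulr1n ?mulr0n; ring.
Qed.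

Local Notation zc q := (q 0 (4 : 'I_6)).

Lemma leval_adm_diag e (i : 'I_6) q : U q ->
  `[adm_diag e i]_q = (1 + c * zc q) ^ e * s *
  ((1 + x1 * zc q) / x1 * (2 / (1 + normsq 0 1 q) ^+ 2) * ((i == 0)%:R + (i == 1)%:R)
   - (1 + x2 * zc q) / x2 * (2 / (1 + normsq 2 3 q) ^+ 2) * ((i == 2)%:R + (i == 3)%:R)
   + (Theta_of (zc q))^-1 * (i == 4)%:R).
Proof.
move=> Uq.
have n01 := normsq1_neq0 0 1 q; have n23 := normsq1_neq0 2 3 q.
have /= ha := adm_w_neq0 Uq 2; have /= hb := adm_w_neq0 Uq 3.
have /= hF := adm_w_neq0 Uq 5.
have x10 : x1 != 0 by case/andP: x1_itv => ? _; rewrite gt_eqF.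
have x20 : x2 != 0 by case/andP: x2_itv => _ ?; rewrite lt_eqF.
rewrite /Theta_of; set fe := (_ ^ e).
case: i => -[|[|[|[|[|[|//]]]]]] h; rewrite /adm_diag /= ?leval_nil ?leval_lmon /=.
all: rewrite -/fe -?exprnP -?exprnN ?expr0 ?expr1 ?mul1r ?mulr1 ?(mulr1z, mulrN1z).
all: field.
all: by rewrite ?n01 ?n23 ?ha ?hb ?hF ?x10 ?x20.
Qed.

Lemma leval_if_diag e (i j : 'I_6) q :
  `[if (i : nat) == j then adm_diag e i else [::]]_q = `[adm_diag e i]_q * (i == j)%:R.
Proof.
rewrite eq_ord_nat; case: eqP => _; rewrite ?mulr1// mulr0; exact: leval_nil.
Qed.

Lemma adm_metricE e q : U q -> forall i j : 'I_6,
  ((1 + c * zc q) ^ e *: admissible_metric s x1 x2 Theta_of q) i j = `[adm_metric e i j]_q.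
Proof.
move=> Uq i j; have wq := adm_w_neq0 Uq.
rewrite /adm_metric tabulate2E// leval_add leval_if_diag !leval_mul// -!thetaE.
rewrite leval_adm_diag// leval_lmon /=.
have -> : 1%:~R * (1 * ((1 + normsq 0 1 q)^-1 ^ 0 * ((1 + normsq 2 3 q)^-1 ^ 0 *
   ((1 + x1 * zc q) ^ (-1) * ((1 + x2 * zc q) ^ (-1) * ((1 + c * zc q) ^ e *
   (F.[zc q] ^ 1 * ((x1 / 2) ^ 0 * ((x2 / 2) ^ 0 * (s ^ 1 * 1)))))))))) =
   (1 + c * zc q) ^ e * s * Theta_of (zc q).
  rewrite !expr0z !expr1z !exprN1 /Theta_of invfM mulr1z; ring.
rewrite /admissible_metric /g1 /g2 /fs_metric; set fe := _ ^ e.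
set T := Theta_of _; set th := theta q.
clearbody fe T.
have dd (k : 'I_6) : (i == k)%:R * (j == k)%:R = (i == k)%:R * (i == j)%:R :> R.
  by case: eqP => [->|_]; rewrite ?mul0r// [j == k]eq_sym.
have scE (A : 'M[R]_6) (t : R) : (t *: A) i j = t * A i j by rewrite mxE.
have adE (A B : 'M[R]_6) : (A + B) i j = A i j + B i j by rewrite mxE.
have opE (A : 'M[R]_6) : (- A) i j = - A i j by rewrite mxE.
rewrite !(scE, adE, opE, sqformE, dxE) !dd; ring.
Qed.

Lemma adm_inverse e q : U q ->
  let h := fun q : E => (1 + c * zc q) ^ e *: admissible_metric s x1 x2 Theta_of q in
  check2 6 (fun i j => lproduct 6 (adm_metric e) (adm_metric_inv e) i j
     == if i == j then [:: (1, ([::], [::]))] else [::]) ->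
  h q \in unitmx /\ forall i j : 'I_6, invmx (h q) i j = `[adm_metric_inv e i j]_q.
Proof.
move=> Uq h /check2P chk.
have prodE (i j : 'I_6) : lproduct 6 (adm_metric e) (adm_metric_inv e) i j
    = if i == j then [:: (1, ([::], [::]))] else [::] by apply/eqP/chk.
by apply: (metric_inverse adm_w_neq0 (g := h) _ Uq prodE) => p Up; exact: adm_metricE.
Qed.


Lemma leval_ldelta (k i : 'I_6) q : `[ldelta i k]_q = (i == k)%:R.
Proof.
rewrite /ldelta eq_ord_nat; case: eqP => _; last exact: leval_nil.
by rewrite leval_lmon /= !mulr1.
Qed.

Definition leval_delta q := (fun i => leval_ldelta 0 i q, fun i => leval_ldelta 1 i q,
  fun i => leval_ldelta 2 i q, fun i => leval_ldelta 3 i q,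
  fun i => leval_ldelta 4 i q, fun i => leval_ldelta 5 i q).

Lemma outerE (a b : E) i j : (a^T *m b) i j = a 0 i * b 0 j.
Proof. by rewrite mxE big_ord1 mxE. Qed.

Lemma horizontal_lift_dxE q (k j : 'I_6) :
  horizontal_lift q (dx k : E) 0 j = (j == k)%:R - theta q 0 k * (j == 5)%:R.
Proof.
rewrite /horizontal_lift mxE dxE mxE mxE big_ord1 dxE; congr (_ - _ * _).
by rewrite -rowE !mxE.
Qed.

Lemma leval_Theta q : U q -> `[lmon 1 [::] [:: 0; 0; -1; -1; 0; 1]]_q = Theta_of (zc q).
Proof.
rewrite leval_lmon /= -?exprnP -?exprnN ?expr0 ?expr1 /Theta_of invfM mulr1z => _.
by ring.
Qed.

Lemma leval_Theta_inv q : U q ->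
  `[lmon 1 [::] [:: 0; 0; 1; 1; 0; -1]]_q = (Theta_of (zc q))^-1.
Proof.
rewrite leval_lmon /= -?exprnP -?exprnN ?expr0 ?expr1 /Theta_of !invfM !invrK.
by rewrite mulr1z => _; ring.
Qed.

Lemma scaleE n m (A : 'M[R]_(n, m)) (t : R) i j : (t *: A) i j = t * A i j.
Proof. by rewrite mxE. Qed.

Lemma addE n m (A B : 'M[R]_(n, m)) i j : (A + B) i j = A i j + B i j.
Proof. by rewrite mxE. Qed.

Lemma oppE n m (A : 'M[R]_(n, m)) i j : (- A) i j = - A i j.
Proof. by rewrite mxE. Qed.

Lemma adm_JE q : U q -> forall i j : 'I_6,
  admissible_J Theta_of q i j = `[adm_J i j]_q.
Proof.
move=> Uq i j; have wq := adm_w_neq0 Uq.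
rewrite /adm_J /adm_lift !(leval_add, leval_scale, leval_mul _ wq).
rewrite !(leval_delta q) -[0%N]/(nat_of_ord (0 : 'I_6)) -[1%N]/(nat_of_ord (1 : 'I_6)).
rewrite -[2%N]/(nat_of_ord (2 : 'I_6)) -[3%N]/(nat_of_ord (3 : 'I_6)).
rewrite -!thetaE leval_Theta// leval_Theta_inv//.
rewrite /admissible_J !(addE, oppE, scaleE, outerE, dxE, horizontal_lift_dxE).
ring.
Qed.

Local Notation g := (admissible_metric s x1 x2 Theta_of).

Lemma adm_metric0E q : U q -> forall i j : 'I_6, g q i j = `[adm_metric 0 i j]_q.
Proof. by move=> Uq i j; rewrite -adm_metricE// expr0z scale1r. Qed.

Lemma leval_adm_diag0 q : U q ->
  `[adm_diag 0 0]_q = s * ((1 + x1 * zc q) / x1 * (2 / (1 + normsq 0 1 q) ^+ 2)) /\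
  `[adm_diag 0 2]_q = - s * ((1 + x2 * zc q) / x2 * (2 / (1 + normsq 2 3 q) ^+ 2)).
Proof.
move=> Uq; have h0 := leval_adm_diag 0 (0 : 'I_6) Uq.
have h2 := leval_adm_diag 0 (2 : 'I_6) Uq.
split; [rewrite h0|rewrite h2]; rewrite expr0z !eqE /=; ring.
Qed.

Lemma adm_formE q : U q -> forall i j : 'I_6,
  admissible_form s x1 x2 q i j = `[adm_form i j]_q.
Proof.
move=> Uq i j; have wq := adm_w_neq0 Uq; have [D0 D2] := leval_adm_diag0 Uq.
rewrite /adm_form !(leval_add, leval_scale, leval_mul _ wq) {}D0 {}D2.
have -> : `[lmon 1 [::] [:: 0; 0; 0; 0; 0; 0; 0; 0; 1]]_q = s.
  by rewrite leval_lmon /= -?exprnP ?expr0 ?expr1 ?mul1r ?mulr1.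
rewrite !(leval_delta q) -!thetaE.
rewrite /admissible_form /omega1 /omega2 /fs_form.
rewrite !(addE, oppE, scaleE, wedgeE, outerE, dxE).
ring.
Qed.

Lemma admissible_kahler_form q : U q ->
  kahler_form g (admissible_J Theta_of) q = admissible_form s x1 x2 q.
Proof.
move=> Uq; apply/matrixP => i j; have wq := adm_w_neq0 Uq.
rewrite /kahler_form (leval_lproduct adm_w_neq0 Uq (adm_JE Uq) (adm_metric0E Uq)).
rewrite adm_formE//.
apply/eqP; rewrite -subr_eq0 -mulN1r; apply/eqP.
rewrite -[-1 : R]/((-1 : int)%:~R) -leval_scale -leval_add.
by rewrite (eqP (check2P adm_form_check i j)) leval_nil.
Qed.

Section KillingPotential.
Variable f : E -> R.
Hypothesis fE : forall q, U q -> f q = 1 + c * zc q.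

Lemma admissible_gradient q : U q ->
  gradient g f q *m admissible_J Theta_of q = (c / s) *: dx 5.
Proof.
move=> Uq; have wq := adm_w_neq0 Uq.
have gu : g q \in unitmx.
  have [] := adm_inverse Uq (adm_inverse_check (mem_head _ _)).
  by rewrite expr0z scale1r.
have Tn0 : Theta_of (zc q) != 0.
  have /= ? := wq 2; have /= ? := wq 3; have /= ? := wq 5.
  by rewrite /Theta_of mulf_neq0// invr_eq0 mulf_neq0.
have th0 : theta q 0 4 = 0 by rewrite thetaE leval_nil.
have [n0 n1 n2 n3] : [/\ ((4 : 'I_6) == 0) = false, ((4 : 'I_6) == 1) = false,
    ((4 : 'I_6) == 2) = false & ((4 : 'I_6) == 3) = false] by split.
have df : \row_i partial i f q = c *: dx 4.
  apply/rowP => i; rewrite !mxE eqxx /=.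
  rewrite (eq_on_partial momentum_domain_open i Uq fE).
  have [_ dE] := is_derive_addf (is_derive_cst (1 : R) q (delta_mx 0 i : E))
    (is_derive_mulf (is_derive_cst c q (delta_mx 0 i : E)) (is_derive_coord 4 i q)).
  by apply: (etrans dE); rewrite mul0r !add0r eq_sym.
(* As theta (d/dz) = 0, row 4 of g is a multiple of dz, so the gradient is found without the entries
   of the inverse. *)
have dxg : (s^-1 * Theta_of (zc q)) *: dx 4 *m g q = dx 4.
  apply/rowP => j; rewrite -scalemxAl scaleE -rowE mxE /admissible_metric /g1 /g2 /fs_metric.
  move: (theta q) th0 => th th0.
  rewrite !(addE, oppE, scaleE, sqformE, dxE) th0 n0 n1 n2 n3 eqxx.
  rewrite !(mulr0n, mulr1n, mul0r, mulr0, addr0, oppr0, add0r, mul1r).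
  by field; rewrite Tn0 gt_eqF.
have -> : gradient g f q = (c * (s^-1 * Theta_of (zc q))) *: dx 4.
  by rewrite /gradient df -[in LHS]dxg -!scalemxAl mulmxK// scalerA.
rewrite -scalemxAl.
apply/rowP => j; rewrite scaleE -rowE mxE.
have outE (a b : E) : (a^T *m b) 4 j = a 0 4 * b 0 j by exact: outerE.
rewrite /admissible_J !addE !oppE !scaleE !outE !dxE th0 n0 n1 n2 n3 eqxx.
rewrite !(mulr0n, mulr1n, mul0r, mulr0, addr0, subr0, oppr0, add0r, mul1r).
by field; rewrite Tn0 gt_eqF.
Qed.

(** The field is a constant multiple of d/dt, and no coefficient of the metric depends on t. *)
Lemma admissible_killing :
  killing_on U (fun p => gradient g f p *m admissible_J Theta_of p) g.
Proof.
move=> q Uq; apply/matrixP => i j; rewrite !mxE.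
have XE p k : U p ->
    (gradient g f p *m admissible_J Theta_of p) 0 k = c / s * (k == 5)%:R.
  by move=> Up; rewrite admissible_gradient// scaleE dxE.
have dX (a k : 'I_6) :
    partial a (fun p => (gradient g f p *m admissible_J Theta_of p) 0 k) q = 0.
  rewrite (eq_on_partial momentum_domain_open a Uq (fun p => XE p k)).
  by have [_] := is_derive_cst (c / s * (k == 5)%:R : R) q (delta_mx 0 a : E).
have dg : partial (5 : 'I_6) (fun p => g p i j) q = 0.
  rewrite (partial_leval momentum_domain_open adm_w_neq0 adm_v_derive adm_w_derive
             (5 : 'I_6) Uq (P := adm_metric 0 i j)); last by move=> p Up; exact: adm_metric0E.
  by rewrite (eqP (check2P adm_killing_check i j)) leval_nil.
apply: big1 => k _; rewrite (dX i k) (dX j k) !mulr0 !addr0 (XE _ _ Uq).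
by case: eqP => [->|_]; rewrite ?dg ?mulr0 ?mul0r.
Qed.

Lemma admissible_scalar_curvature q : U q ->
  scalar_curvature (fun p => (f p) ^- 2 *: g p) q = S / s.
Proof.
move=> Uq; have wq := adm_w_neq0 Uq.
set h := fun p => _.
have hE p : U p -> h p = (1 + c * zc p) ^ (-2) *: g p.
  by move=> Up; rewrite /h fE// -exprnN.
have hm p : U p -> forall i j : 'I_6, h p i j = `[adm_metric (-2) i j]_p.
  by move=> Up i j; rewrite hE// adm_metricE.
have hi p : U p -> forall i j : 'I_6, invmx (h p) i j = `[adm_metric_inv (-2) i j]_p.
  move=> Up; rewrite hE//.
  by have [] := adm_inverse Up (adm_inverse_check (_ : -2 \in _)).
have /= n01 := normsq1_neq0 0 1 q; have n23 := normsq1_neq0 2 3 q.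
have r1 : `[adm_rel1]_q = 0.
  rewrite /adm_rel1 !leval_cons leval_nil /lmono_eval /= -?exprnP -?exprnN.
  by rewrite ?expr0 ?expr1 ?invrK ?mul1r ?mulr1 /normsq; ring.
have r2 : `[adm_rel2]_q = 0.
  rewrite /adm_rel2 !leval_cons leval_nil /lmono_eval /= -?exprnP -?exprnN.
  by rewrite ?expr0 ?expr1 ?invrK ?mul1r ?mulr1 /normsq; ring.
have reduce Q : ladd Q (lscale (-1) (ladd adm_scalar4 (ladd
    (lmul adm_cofactor1 adm_rel1) (lmul adm_cofactor2 adm_rel2)))) = [::] ->
    `[Q]_q = `[adm_scalar4]_q.
  move=> /(congr1 (leval (adm_v q) (adm_w q))); rewrite leval_nil leval_add leval_scale.
  rewrite leval_add leval_add (leval_mul _ wq) (leval_mul _ wq) r1 r2 !mulr0 !addr0.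
  by rewrite mulrN1z mulN1r => /eqP; rewrite subr_eq0 => /eqP.
have sc := etrans (scalar_curvature_leval momentum_domain_open adm_w_neq0
  adm_v_derive adm_w_derive hm hi Uq) (reduce _ adm_scalar4_check).
apply: (mulfI (_ : 4 != 0)); rewrite ?pnatr_eq0// sc.
have /= ha := wq 2; have /= hb := wq 3; have /= hf := wq 4; have hs := gt_eqF s_gt0.
rewrite /adm_scalar4 !leval_cons leval_nil /lmono_eval /= -?exprnP -?exprnN.
rewrite ?expr0 ?expr1 ?mul1r ?mulr1.
have ode := F_ode (zc q).
have -> : S = (4 * (x1 - x2) * (1 + c * zc q) ^+ 2
  - ((1 + c * zc q) ^+ 2 * F^`()^`().[zc q]
     - 10 * c * (1 + c * zc q) * F^`().[zc q] + 30 * c ^+ 2 * F.[zc q]))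
  / ((1 + x1 * zc q) * (1 + x2 * zc q)).
  by rewrite ode; field; rewrite ha hb.
by field; rewrite ha hb hs.
Qed.

End KillingPotential.
End AdmissibleGeometry.

(** * Fibre norm and momentum *)

Section RationalProfile.
Variable R : realType.
Implicit Types (z : R) (p q : {poly R}).

Lemma near_itv (a b z : R) : a < z < b -> \forall y \near z, a < y < b.
Proof.
move=> zab; have /near_in_itvoo : z \in `]a, b[ by rewrite in_itv.
by apply: filterS => y; rewrite in_itv.
Qed.

(** Quotients by powers of q are stable under differentiation, so p / q is infinitely differentiable
    away from the zeros of q. *)
Lemma ratio_derive1n p q (a b : R) : (forall z, a < z < b -> q.[z] != 0) ->
  forall k, exists N m, forall z, a < z < b ->
    ((fun y => p.[y] / q.[y])^`(k))%classic z = N.[z] / (q ^+ m).[z].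
Proof.
move=> q0; elim=> [|k [N [m IHk]]].
  by exists p, 1%N => z _; rewrite derive1n0 expr1.
exists (N^`() * q ^+ m - N * (q ^+ m)^`()), (m + m)%N => z zab.
have qm0 : (q ^+ m).[z] != 0 by rewrite horner_exp expf_neq0// q0.
rewrite derive1nS derive1E (near_eq_derive (g := fun y => N.[y] / (q ^+ m).[y])).
  have [_ ->] := is_derive_ratio N qm0.
  by rewrite exprD !hornerE /=; congr (_ / _); rewrite !horner_exp.
by apply: filterS (near_itv zab) => y; exact: IHk.
Qed.

Lemma ratio_derivable p q (a b : R) : (forall z, a < z < b -> q.[z] != 0) ->
  forall k z, a < z < b ->
    derivable ((fun y => p.[y] / q.[y])^`(k))%classic z 1.
Proof.
move=> q0 k z zab; have [N [m Nm]] := ratio_derive1n p q0 k.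
have qm0 : (q ^+ m).[z] != 0 by rewrite horner_exp expf_neq0// q0.
have [dr _] := is_derive_ratio N qm0.
apply: near_eq_derivable dr.
by apply: filterS (near_itv zab) => y /Nm ->.
Qed.

Lemma ratio_momentum_profile (x1 x2 : R) (H : {poly R}) :
  0 < x1 < 1 -> -1 < x2 < 0 ->
  H.[1] = (base_poly x1 x2).[1] -> H.[-1] = (base_poly x1 x2).[-1] ->
  (forall z, -1 < z < 1 -> 0 < H.[z]) ->
  momentum_profile (fun z => ((1 - 'X^2) * H).[z] / (base_poly x1 x2).[z]).
Proof.
move=> /andP[x10 x11] /andP[x21 x20] H1 HN1 H_gt0.
set F := _ * H; set p := base_poly x1 x2.
(* The zeros of p are -1 / x1 and -1 / x2. Since t + 1 / t > 2 for 0 < t < 1, both lie outside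
   [-1 - e, 1 + e]. *)
pose e := Num.min (1 - x1) (1 + x2).
have e0 : 0 < e by rewrite lt_min; apply/andP; split; lra.
have [e1 e2] : e <= 1 - x1 /\ e <= 1 + x2 by rewrite !ge_min !lexx orbT.
have p_gt0 z : -1 - e < z < 1 + e -> 0 < p.[z].
  move=> /andP[z1 z2]; rewrite base_polyE.
  apply: mulr_gt0; last first.
    have [z0|z0] := leP 0 z; first by nra.
    by rewrite ltr_pwDl// mulr_le0// ltW.
  have [z0|z0] := leP 0 z; last by nra.
  by rewrite ltr_pwDl// mulr_ge0// ltW.
have p0 z : -1 - e < z < 1 + e -> p.[z] != 0 by move=> /p_gt0/lt0r_neq0.
have one_itv : -1 - e < (1 : R) < 1 + e by lra.
have N1_itv : -1 - e < (-1 : R) < 1 + e by lra.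
have [F1 FN1] : F.[1] = 0 /\ F.[-1] = 0.
  by rewrite /F !hornerE sqrrN !expr1n subrr !mul0r.
(* At the ends only the first term survives, and H = p there turns it into the slopes 2 and -2 of
   Theta. *)
have dF z : F^`().[z] = - 2 * z * H.[z] + (1 - z ^+ 2) * H^`().[z].
  by rewrite /F derivM derivB derivXn derivC !hornerE /=; ring.
split.
- exists e => // k z; exact: ratio_derivable.
- move=> z z_itv; have /andP[z1 z2] := z_itv; rewrite divr_gt0//.
    by rewrite hornerM mulr_gt0 ?H_gt0// !hornerE; nra.
  by apply: p_gt0; lra.
- by rewrite F1 FN1 !mul0r.
rewrite !derive1E; have [_ ->] := is_derive_ratio F (p0 _ N1_itv).
have [_ ->] := is_derive_ratio F (p0 _ one_itv).
have h1 := p0 _ one_itv; have hN := p0 _ N1_itv.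
by rewrite F1 FN1 !dF H1 HN1; split; field.
Qed.

End RationalProfile.

Section Antiderivative.
Variable R : realType.

Lemma continuous_antiderivative (f : R -> R) (a b : R) : continuous f ->
  exists K : R -> R, forall x, a < x < b -> is_derive x 1 K (f x).
Proof.
move=> fc; exists (fun x => \int[lebesgue_measure]_(t in `[a, x]) f t)%R.
move=> x /andP[ax xb].
have fi : lebesgue_measure.-integrable `[a, b] (EFin \o f).
  apply: continuous_compact_integrable; first exact: segment_compact.
  exact: continuous_subspaceT.
have [dK <-] := continuous_FTC1_closed xb fi ax (fc x).
by rewrite derive1E; exact: derivableP.
Qed.

End Antiderivative.

Section NormOfMomentum.
Variable R : realType.
Implicit Types (z r : R).

(** The squared fibre norm: the slopes of Theta force a simple zero at z = -1 and a simple pole at z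
    = 1, and L is the regular positive factor. *)
Definition norm_of (L : R -> R) z : R := (1 + z) / (1 - z) * L z.

Lemma is_derive_norm_of (L : R -> R) (a : R) z : z < 1 ->
  is_derive z 1 L (- 2 * a * L z) ->
  is_derive z 1 (norm_of L) (2 * (1 - (1 - z ^+ 2) * a) * L z / (1 - z) ^+ 2).
Proof.
move=> z1 dL; have nz : 1 - z != 0 by rewrite subr_eq0 eq_sym lt_eqF.
have d1 : is_derive z 1 (fun y : R => 1 + y) 1.
  apply: is_derive_eq (is_derive_addf (is_derive_cst (1 : R) z 1)
    (is_derive_id z 1)) _.
  exact: add0r.
have d2 : is_derive z 1 (fun y : R => 1 - y) (- 1).
  apply: is_derive_eq (is_derive_addf (is_derive_cst (1 : R) z 1)
    (is_derive_oppf (is_derive_id z 1))) _.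
  exact: add0r.
apply: is_derive_eq (is_derive_mulf (is_derive_mulf d1
  (@is_derive_invf _ _ (fun y : R => 1 - y) _ _ _ nz d2)) dL) _.
by field.
Qed.

Lemma norm_of_inverse (L phi : R -> R) (d : R) : 0 < d ->
  (forall z, -1 - d < z < 1 + d ->
     [/\ 0 < L z, is_derive z 1 L (- 2 * phi z * L z)
       & 0 < 1 - (1 - z ^+ 2) * phi z]) ->
  exists Z : R -> R,
    (forall z, -1 <= z < 1 -> Z (norm_of L z) = z) /\
    (forall r, 0 <= r -> [/\ -1 <= Z r < 1, norm_of L (Z r) = r &
       is_derive r 1 Z ((1 - Z r) ^+ 2 /
         (2 * (1 - (1 - Z r ^+ 2) * phi (Z r)) * L (Z r)))]).
Proof.
move=> d0 hyp; set rho := norm_of L.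
pose drho z := 2 * (1 - (1 - z ^+ 2) * phi z) * L z / (1 - z) ^+ 2.
have rho_derive z : -1 - d < z < 1 -> is_derive z 1 rho (drho z).
  move=> /andP[z1 z2]; have [|L0 dL _] := hyp z; first by lra.
  exact: is_derive_norm_of.
have drho_gt0 z : -1 - d < z < 1 -> 0 < drho z.
  move=> /andP[z1 z2]; have [|L0 _ J0] := hyp z; first by lra.
  by rewrite /drho divr_gt0 ?exprn_gt0 ?subr_gt0 ?mulr_gt0.
have rho_lt u v : -1 - d < u -> u < v -> v < 1 -> rho u < rho v.
  move=> u1 uv v1; have [|y /andP[y1 y2] e] := @MVT_itv _ rho drho _ _ uv.
    by move=> y /andP[y1 y2]; apply: rho_derive; lra.
  by rewrite -subr_gt0 e mulr_gt0 ?subr_gt0// drho_gt0//; lra.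
have rho_inj u v : -1 - d < u < 1 -> -1 - d < v < 1 -> rho u = rho v -> u = v.
  move=> /andP[u1 u2] /andP[v1 v2] uv; have [h|h|//] := ltgtP u v.
    by have := rho_lt _ _ u1 h v2; rewrite uv ltxx.
  by have := rho_lt _ _ v1 h u2; rewrite uv ltxx.
have rhoN1 : rho (-1) = 0 by rewrite /rho /norm_of subrr !mul0r.
have rho_ge0 z : -1 <= z < 1 -> 0 <= rho z.
  move=> /andP[z1 z2]; have [|L0 _ _] := hyp z; first by lra.
  by rewrite mulr_ge0 ?divr_ge0//; lra.
have surj r : 0 <= r -> exists2 z, -1 <= z < 1 & rho z = r.
  move=> r0.
  have [L1 dL1 _] : [/\ 0 < L 1, is_derive (1 : R) 1 L (- 2 * phi 1 * L 1)
       & 0 < 1 - (1 - (1 : R) ^+ 2) * phi 1] by apply: hyp; lra.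
  have cL : {for 1, continuous L}.
    by apply/differentiable_continuous/derivable1_diffP; case: dL1.
  have L2 : L 1 / 2 < L 1 by lra.
  have nL : \forall z \near (1 : R), L 1 / 2 < L z by move/cvgr_gt : cL; apply.
  have /nbhs_ballP[e /= e0 he] := nL.
  (* The three bounds give L (1 - t) > L 1 / 2, 2 - t >= 1 and t (r + 1) <= L 1 / 2, so the norm at
     1 - t exceeds r. *)
  pose t := Num.min (e / 2) (Num.min 1 (L 1 / (2 * (r + 1)))).
  have t0 : 0 < t.
    by rewrite !lt_min ltr01 !divr_gt0// mulr_gt0//; lra.
  have [te t1 tL] : [/\ t <= e / 2, t <= 1 & t <= L 1 / (2 * (r + 1))].
    by rewrite /t !ge_min !lexx !orbT.
  have zlt : L 1 / 2 < L (1 - t).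
    by apply: he; rewrite /ball /= opprB addrC subrK gtr0_norm//; lra.
  have big : r < rho (1 - t).
    have -> : rho (1 - t) = (2 - t) * L (1 - t) / t.
      by rewrite /rho /norm_of subKr mulrAC addrA.
    rewrite ltr_pdivlMr//.
    have : t * (2 * (r + 1)) <= L 1 by rewrite -ler_pdivlMr// mulr_gt0//; lra.
    by nra.
  have [|||z z_itv zr] := @IVT _ rho (-1) (1 - t) r.
  - by lra.
  - apply: derivable_within_continuous => z; rewrite in_itv /= => /andP[z1 z2].
    by have [|] := rho_derive z; first by lra.
  - by rewrite rhoN1 ge_min r0 /= le_max (ltW big) orbT.
  by exists z => //; move: z_itv; rewrite in_itv /=; lra.
pose D r := [set z | -1 - d < z < 1 /\ rho z = r].
pose Z r := xget 0 (D r).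
have ZK z : -1 - d < z < 1 -> Z (rho z) = z.
  move=> zd; rewrite /Z; case: xgetP => [y _ [yd yz]|/(_ z)[]//].
  exact: rho_inj.
exists Z; split=> [z /andP[z1 z2]|r r0]; first by apply: ZK; lra.
have [z z_itv zr] := surj _ r0.
have zd : -1 - d < z < 1 by lra.
have Zr : Z r = z by rewrite -zr ZK.
rewrite Zr; split=> //; rewrite -zr.
have -> : (1 - z) ^+ 2 / (2 * (1 - (1 - z ^+ 2) * phi z) * L z) = (drho z)^-1.
  by rewrite /drho invf_div.
apply: (@is_derive_inverse _ rho Z).
- by apply: filterS (near_itv zd) => y; exact: ZK.
- apply: filterS (near_itv zd) => y /rho_derive[dy _].
  exact/differentiable_continuous/derivable1_diffP.
- exact: rho_derive.
- by rewrite gt_eqF// drho_gt0.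
Qed.

End NormOfMomentum.

(** * Rings of smooth functions closed under partial derivatives *)

Section SmoothRing.
Variables (R : realType) (n : nat).
Local Notation E := 'rV[R]_n.+1.
Implicit Types (A : (E -> R) -> Prop) (f g : E -> R) (x : E) (i : 'I_n.+1).

(* The ring of functions generated by A and by inversion of nowhere vanishing
   elements.  If it contains the partial derivatives of its generators, it is
   closed under all partial derivatives, hence made of smooth functions. *)
Inductive generated A : (E -> R) -> Prop :=
| gen_atom f of A f : generated A f
| gen_cst (a : R) : generated A (fun=> a)
| gen_add f g of generated A f & generated A g : generated A (fun x => f x + g x)
| gen_mul f g of generated A f & generated A g : generated A (fun x => f x * g x)
| gen_inv f of generated A f & (forall x, f x != 0) : generated A (fun x => (f x)^-1).

Lemma generated_sub A B f : (forall h, A h -> B h) -> generated A f -> generated B f.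
Proof.
move=> AB; elim=> {f} [f Af|a|f g _ Bf _ Bg|f g _ Bf _ Bg|f _ Bf f0].
- exact/gen_atom/AB.
- exact: gen_cst.
- exact: gen_add.
- exact: gen_mul.
- exact: gen_inv.
Qed.

Lemma generated_horner A f (p : {poly R}) :
  generated A f -> generated A (fun x => p.[f x]).
Proof.
move=> Af; elim/poly_ind: p => [|p a IHp].
  under eq_fun do rewrite horner0; exact: gen_cst.
under eq_fun do rewrite hornerMXaddC.
by apply: gen_add; [exact: gen_mul|exact: gen_cst].
Qed.

Lemma partial_is_derive f i x : differentiable f x ->
  is_derive x (delta_mx 0 i : E) f (partial i f x).
Proof. by move=> df; apply/derivableP/diff_derivable. Qed.

Section Closed.
Variable A : (E -> R) -> Prop.
Hypothesis A_diff : forall f x, A f -> differentiable f x.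

Lemma generated_differentiable f x : generated A f -> differentiable f x.
Proof.
elim=> {f} [f Af|a|f g _ df _ dg|f g _ df _ dg|f _ df f0].
- exact: A_diff.
- exact: differentiable_cst.
- exact: differentiableD.
- exact: differentiableM.
- exact: differentiableV.
Qed.

Hypothesis A_partial : forall f i, A f -> generated A (partial i f).

Lemma generated_partial f i : generated A f -> generated A (partial i f).
Proof.
elim=> {f} [f Af|a|f g gf Pf gg Pg|f g gf Pf gg Pg|f gf Pf f0].
- exact: A_partial.
- have -> : partial i (fun=> a) = (fun=> 0).
    by apply/funext => x; have [_] := is_derive_cst a x (delta_mx 0 i : E).
  exact: gen_cst.
- have -> : partial i (fun x => f x + g x) = (fun x => partial i f x + partial i g x).
    apply/funext => x; have df := generated_differentiable x gf.
    have dg := generated_differentiable x gg.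
    by have [_] := is_derive_addf (partial_is_derive i df) (partial_is_derive i dg).
  exact: gen_add.
- have -> : partial i (fun x => f x * g x) =
            (fun x => partial i f x * g x + f x * partial i g x).
    apply/funext => x; have df := generated_differentiable x gf.
    have dg := generated_differentiable x gg.
    by have [_] := is_derive_mulf (partial_is_derive i df) (partial_is_derive i dg).
  by apply: gen_add; apply: gen_mul.
have -> : partial i (fun x => (f x)^-1) =
          (fun x => (-1 * partial i f x) * ((f x)^-1 * (f x)^-1)).
  apply/funext => x; have df := generated_differentiable x gf.
  have [_ dE] := is_derive_invf (f0 x) (partial_is_derive i df).
  by apply: (etrans dE); rewrite mulN1r -invfM.
apply: gen_mul; first by apply: gen_mul => //; exact: gen_cst.
by apply: gen_mul; exact: gen_inv.
Qed.

Lemma generated_smooth f : generated A f -> smooth f.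
Proof.
move=> gf s x; apply: generated_differentiable.
by elim: s => //= i s; exact: generated_partial.
Qed.

End Closed.

Definition coordinate f : Prop := exists k : 'I_n.+1, f = (fun x => x 0 k).

Lemma coordinate_differentiable f x : coordinate f -> differentiable f x.
Proof. by move=> [k ->]; exact: differentiable_coord. Qed.

Lemma coordinate_partial f i : coordinate f -> generated coordinate (partial i f).
Proof.
move=> [k ->]; have -> : partial i (fun x : E => x 0 k) = (fun=> (k == i)%:R).
  by apply/funext => x; have [_] := is_derive_coord k i x.
exact: gen_cst.
Qed.

(* The derivatives of Z and of L o Z are rational expressions in Z and L o Z, so
   that the coordinates, Z o r and L o Z o r generate a ring closed under partial
   derivatives. *)
Lemma inverse_norm_smooth (r : E -> R) (Z L phi : R -> R) (N P : {poly R}) (a b : R) :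
  generated coordinate r -> (forall x, 0 <= r x) ->
  (forall t, 0 <= t -> [/\ -1 <= Z t < 1, 0 < L (Z t), P.[Z t] != 0,
     is_derive t 1 Z ((1 - Z t) ^+ 2 / (2 * (1 - (1 - Z t ^+ 2) * phi (Z t)) * L (Z t)))
     & is_derive (Z t) 1 L (- 2 * phi (Z t) * L (Z t))] /\
     [/\ phi (Z t) = N.[Z t] / P.[Z t] & 1 - (1 - Z t ^+ 2) * phi (Z t) != 0]) ->
  smooth (fun x => a + b * Z (r x)).
Proof.
move=> gr r0 hZ.
pose A f := [\/ coordinate f, f = (fun x => Z (r x)) | f = (fun x => L (Z (r x)))].
have cA f : generated coordinate f -> generated A f.
  by apply: generated_sub => h; exact: Or31.
have rD x : differentiable r x.
  exact: (generated_differentiable coordinate_differentiable).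
have ZD x : differentiable (fun y => Z (r y)) x.
  have [[_ _ _ [dZ _] _] _] := hZ _ (r0 x).
  by apply: differentiable_comp => //; exact/derivable1_diffP.
have LD x : differentiable (fun y => L (Z (r y))) x.
  have [[_ _ _ _ [dL _]] _] := hZ _ (r0 x).
  by apply: (@differentiable_comp _ _ _ _ (fun y => Z (r y)) L) => //; exact/derivable1_diffP.
have AZ : generated A (fun x => Z (r x)) by exact/gen_atom/Or32.
have AL : generated A (fun x => L (Z (r x))) by exact/gen_atom/Or33.
have Aphi : generated A (fun x => phi (Z (r x))).
  have -> : (fun x => phi (Z (r x))) = (fun x => N.[Z (r x)] * (P.[Z (r x)])^-1).
    by apply/funext => x; have [_ []] := hZ _ (r0 x).
  apply: gen_mul; first exact: generated_horner.
  apply: gen_inv; first exact: generated_horner.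
  by move=> x; have [[]] := hZ _ (r0 x).
(* Spelled with sums and products only, to match the constructors of [generated]. *)
pose J x := 1 + -1 * ((1 + -1 * (Z (r x) * Z (r x))) * phi (Z (r x))).
have AJ : generated A J.
  apply: gen_add; first exact: gen_cst.
  apply: gen_mul; first exact: gen_cst.
  apply: gen_mul => //; apply: gen_add; first exact: gen_cst.
  by apply: gen_mul; [exact: gen_cst|exact: gen_mul].
have JE x : J x = 1 - (1 - Z (r x) ^+ 2) * phi (Z (r x)) by rewrite /J; ring.
have Ar i : generated A (partial i r).
  apply: cA; apply: generated_partial gr; first exact: coordinate_differentiable.
  exact: coordinate_partial.
pose dZ i x := (1 + -1 * Z (r x)) * (1 + -1 * Z (r x))
  * (2 * J x * L (Z (r x)))^-1 * partial i r x.
have dZE i x : is_derive x (delta_mx 0 i : E) (fun y => Z (r y)) (dZ i x).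
  have [[_ _ _ dZt _] _] := hZ _ (r0 x).
  apply: is_derive_eq (is_derive_comp dZt (partial_is_derive i (rD x))) _.
  by rewrite /dZ JE; congr (_ * _ * _); ring.
have AdZ i : generated A (dZ i).
  apply: gen_mul => //; apply: gen_mul.
    apply: gen_mul; apply: gen_add; try exact: gen_cst.
      by apply: gen_mul => //; exact: gen_cst.
    by apply: gen_mul => //; exact: gen_cst.
  apply: gen_inv.
    by apply: gen_mul => //; apply: gen_mul => //; exact: gen_cst.
  move=> x; have [[_ L0 _ _ _] [_ J0]] := hZ _ (r0 x).
  by rewrite !mulf_neq0 ?pnatr_eq0 ?JE// gt_eqF.
apply: (@generated_smooth A); last first.
- by apply: gen_add; [exact: gen_cst|apply: gen_mul => //; exact: gen_cst].
- move=> f i [/coordinate_partial/cA//| -> | ->].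
  have -> // : partial i (fun x => Z (r x)) = dZ i.
  by apply/funext => x; have [_] := dZE i x.
have -> : partial i (fun x => L (Z (r x))) =
    (fun x => -2 * phi (Z (r x)) * L (Z (r x)) * dZ i x).
  apply/funext => x; have [[_ _ _ _ dL] _] := hZ _ (r0 x).
  by have [_] := is_derive_comp (g := fun y => Z (r y)) dL (dZE i x).
apply: gen_mul => //; apply: gen_mul => //.
by apply: gen_mul => //; exact: gen_cst.
- by move=> f x [/coordinate_differentiable| -> | ->].
Qed.

End SmoothRing.

(** * The momentum as a smooth function of the squared fibre norm *)

Section MomentumInverse.
Variables (R : realType) (p k H : {poly R}).
Hypothesis HE : H = p + (1 - 'X^2) * k.
Hypothesis H_gt0 : forall z, -1 <= z <= 1 -> 0 < H.[z].
Hypothesis p_gt0 : forall z, -1 <= z <= 1 -> 0 < p.[z].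

(** Compactness bounds H below on [-1, 1], and continuity at the ends carries half the minimum
    slightly beyond, as [norm_of_inverse] requires. *)
Lemma near_segment_gt0 : exists m d : R, [/\ 0 < m, 0 < d, d < 1 &
  forall z, -1 - d < z < 1 + d -> m < H.[z] /\ 0 < p.[z]].
Proof.
have [||c c_itv cmin] := @EVT_min _ (horner H) (-1) 1.
- by lra.
- by apply: continuous_subspaceT; exact: continuous_horner.
move: c_itv; rewrite in_itv /= => c_itv.
pose m := H.[c] / 2; have Hc := H_gt0 c_itv.
have m0 : 0 < m by rewrite divr_gt0.
have mH z : -1 <= z <= 1 -> m < H.[z].
  move=> z_itv; apply: lt_le_trans (cmin z _); last by rewrite in_itv.
  by rewrite /m; lra.
have nearby (e : R) : -1 <= e <= 1 ->
    exists2 r, 0 < r & forall z, `|e - z| < r -> m < H.[z] /\ 0 < p.[z].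
  move=> e_itv; have nH : \forall z \near e, m < H.[z].
    by have /cvgr_gt := @continuous_horner _ H e; apply; exact: mH.
  have np : \forall z \near e, 0 < p.[z].
    by have /cvgr_gt := @continuous_horner _ p e; apply; exact: p_gt0.
  have nHp : \forall z \near e, m < H.[z] /\ 0 < p.[z] by apply: filterS2 nH np.
  have /nbhs_ballP[r /= r0 hr] := nHp.
  by exists r => // z ez; apply: hr.
have [|r1 r10 h1] := nearby 1; first by lra.
have [|r2 r20 h2] := nearby (-1); first by lra.
pose d := Num.min (1 / 2) (Num.min r1 r2).
have d0 : 0 < d by rewrite !lt_min r10 r20 divr_gt0.
have [d1 dr1 dr2] : [/\ d <= 1 / 2, d <= r1 & d <= r2].
  by rewrite /d !ge_min !lexx !orbT.
exists m, d; split=> //; first by lra.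
move=> z /andP[z1 z2]; have [zn|zn] := ltP z (-1).
  by apply: h2; rewrite gtr0_norm; lra.
have [zp|zp] := ltP 1 z; first by apply: h1; rewrite ltr0_norm; lra.
by split; [apply: mH|apply: p_gt0]; rewrite zn.
Qed.

Lemma momentum_inverse : exists L Z1 Z2 : R -> R,
  [/\ forall z, -1 < z < 1 -> 0 < norm_of L z /\
        is_derive z 1 (norm_of L)
          (2 * norm_of L z * (p.[z] / ((1 - 'X^2) * H).[z])),
      forall z, -1 <= z < 1 -> Z1 (norm_of L z) = z,
      forall r, 0 <= r -> -1 <= Z1 r < 1,
      Z2 0 = -1 /\ (forall r, 0 < r -> Z2 r^-1 = - Z1 r) &
      forall n (r : 'rV[R]_n.+1 -> R) a b, generated (@coordinate R n) r ->
        (forall x, 0 <= r x) ->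
        smooth (fun x => a + b * Z1 (r x)) /\ smooth (fun x => a + b * Z2 (r x))].
Proof.
have [m [d [m0 d0 d1 md]]] := near_segment_gt0.
(* H may vanish far from [-1, 1]; the truncation by m makes phi continuous everywhere, hence
   integrable, and equal to k / H near the segment. *)
pose phi z := k.[z] * (Num.max H.[z] m)^-1.
have max_gt0 z : 0 < Num.max H.[z] m by rewrite lt_max m0 orbT.
have phi_cont : continuous phi.
  move=> z; apply: continuousM; first exact: continuous_horner.
  apply: continuousV; first by rewrite gt_eqF.
  by apply: continuous_max; [exact: continuous_horner|exact: cst_continuous].
have [K dK] := continuous_antiderivative (-2) 2 phi_cont.
have phiE z : -1 - d < z < 1 + d -> phi z = k.[z] / H.[z].
  by move=> /md[mz _]; rewrite /phi max_l// ltW.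
(* From p = H - (1 - z^2) k; this makes the logarithmic derivative of the squared norm equal to 2 /
   Theta. *)
have JE z : -1 - d < z < 1 + d -> 1 - (1 - z ^+ 2) * phi z = p.[z] / H.[z].
  move=> zd; rewrite phiE//; have [mz _] := md _ zd.
  have Hz : H.[z] != 0 by rewrite gt_eqF// (lt_trans m0).
  have -> : p.[z] = H.[z] - (1 - z ^+ 2) * k.[z].
    by rewrite HE hornerD [((_ - _) * k).[z]]hornerM !hornerE /= addrK.
  by field.
have J_gt0 z : -1 - d < z < 1 + d -> 0 < 1 - (1 - z ^+ 2) * phi z.
  by move=> zd; rewrite JE//; have [mz pz] := md _ zd; rewrite divr_gt0// (lt_trans m0).
pose L z := expR (- 2 * K z).
have L_gt0 z : 0 < L z by exact: expR_gt0.
have L_derive z : -1 - d < z < 1 + d -> is_derive z 1 L (- 2 * phi z * L z).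
  move=> zd; have dKz : is_derive z 1 K (phi z) by apply: dK; lra.
  apply: is_derive_eq (is_derive_comp (is_derive_expR _)
    (is_derive_mulf (is_derive_cst (- 2 : R) z 1) dKz)) _.
  by rewrite /L /=; ring.
(* The reflection z -> - z exchanges the ends and inverts the norm, so the section z = 1 is treated
   like z = -1, with [Z2] in place of [Z1]. *)
pose L2 z := (L (- z))^-1; pose phi2 z := phi (- z).
have opp_itv z : -1 - d < z < 1 + d -> -1 - d < - z < 1 + d by lra.
have L2_gt0 z : 0 < L2 z by rewrite invr_gt0.
have L2_derive z : -1 - d < z < 1 + d -> is_derive z 1 L2 (- 2 * phi2 z * L2 z).
  move=> zd; have Ln : L (- z) != 0 by rewrite gt_eqF.
  apply: is_derive_eq (@is_derive_invf _ _ (fun y => L (- y)) z 1 _ Ln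
    (is_derive_comp (L_derive _ (opp_itv _ zd)) (is_derive_oppf (is_derive_id z 1)))) _.
  by rewrite /L2 /phi2; field.
have [Z1 [Z1K Z1r]] := @norm_of_inverse R L phi d d0
  (fun z zd => And3 (L_gt0 z) (L_derive z zd) (J_gt0 z zd)).
have J2_gt0 z : -1 - d < z < 1 + d -> 0 < 1 - (1 - z ^+ 2) * phi2 z.
  by move=> zd; rewrite -[z ^+ 2]sqrrN; exact: J_gt0 (opp_itv _ zd).
have [Z2 [Z2K Z2r]] := @norm_of_inverse R L2 phi2 d d0
  (fun z zd => And3 (L2_gt0 z) (L2_derive z zd) (J2_gt0 z zd)).
have itv_d z : -1 <= z < 1 -> -1 - d < z < 1 + d by lra.
exists L, Z1, Z2; split=> //.
- move=> z /andP[z1 z2]; have zd : -1 - d < z < 1 + d by lra.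
  have rho0 : 0 < norm_of L z by rewrite !mulr_gt0// ?invr_gt0; lra.
  split=> //.
  have nz : 1 - z != 0 by rewrite subr_eq0 eq_sym lt_eqF.
  have nz1 : 1 + z != 0 by rewrite gt_eqF//; lra.
  apply: is_derive_eq (is_derive_norm_of z2 (L_derive _ zd)) _.
  have -> : p.[z] / ((1 - 'X^2) * H).[z] = (1 - (1 - z ^+ 2) * phi z) / (1 - z ^+ 2).
    by rewrite hornerM JE// !hornerE invfM mulrCA mulrC.
  rewrite /norm_of /=; field; rewrite nz /=.
  have -> : 1 - z ^+ 2 = (1 - z) * (1 + z) by ring.
  by rewrite mulf_neq0.
- by move=> r /Z1r[].
- split.
    have := Z2K (-1); rewrite /norm_of subrr !mul0r; apply; lra.
  move=> r r0; have [/andP[z1 z2] zr _] := Z1r _ (ltW r0).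
  have z1' : -1 < Z1 r.
    rewrite lt_neqAle z1 andbT; apply/eqP => zE.
    by move: r0; rewrite -zr -zE /norm_of subrr !mul0r ltxx.
  rewrite -{1}zr -[RHS]Z2K; last by lra.
  congr Z2; rewrite /norm_of /L2 opprK; field.
  by rewrite !gt_eqF//; lra.
move=> n r a b gr r0; split.
- apply: (@inverse_norm_smooth _ _ r Z1 L phi k H) => // t t0.
  have [z_itv _ dZ] := Z1r _ t0; have zd := itv_d _ z_itv; have [mz _] := md _ zd.
  split; split=> //; first by rewrite gt_eqF// (lt_trans m0).
  + exact: L_derive.
  + exact: phiE.
  + by rewrite gt_eqF// J_gt0.
apply: (@inverse_norm_smooth _ _ r Z2 L2 phi2 (k \Po (- 'X)) (H \Po (- 'X))) => // t t0.
have [z_itv _ dZ] := Z2r _ t0; have zd := itv_d _ z_itv; have [mz _] := md _ (opp_itv _ zd).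
have hP (q : {poly R}) z : (q \Po (- 'X)).[z] = q.[- z] by rewrite horner_comp !hornerE.
split; split=> //.
+ by rewrite hP gt_eqF// (lt_trans m0).
+ exact: L2_derive.
+ by rewrite !hP; exact: phiE (opp_itv _ zd).
by rewrite gt_eqF// J2_gt0.
Qed.

End MomentumInverse.

(** * The Killing potential as a smooth function on M *)

Section Potential.
Variables (R : realType) (c : R) (Z1 Z2 : R -> R).
Local Notation E := 'rV[R]_6.
Hypothesis c_itv : -1 < c < 1.
Hypothesis Z1_itv : forall r, 0 <= r -> -1 <= Z1 r < 1.
Hypothesis Z2_0 : Z2 0 = -1.
Hypothesis Z2_V : forall r, 0 < r -> Z2 r^-1 = - Z1 r.
Hypothesis Z_smooth : forall n (r : 'rV[R]_n.+1 -> R) a b,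
  generated (@coordinate R n) r -> (forall x, 0 <= r x) ->
  smooth (fun x => a + b * Z1 (r x)) /\ smooth (fun x => a + b * Z2 (r x)).

Definition sqmod (z : R[i]) : R := complex.Re z ^+ 2 + complex.Im z ^+ 2.

Lemma sqmodM z w : sqmod (z * w) = sqmod z * sqmod w.
Proof. by case: z => a b; case: w => a' b'; rewrite /sqmod /=; ring. Qed.

Lemma sqmod1 : sqmod 1 = 1.
Proof. by rewrite /sqmod /= expr0n expr1n addr0. Qed.

Lemma sqmod_ge0 z : 0 <= sqmod z.
Proof. by rewrite addr_ge0 ?sqr_ge0. Qed.

Lemma sqmod_gt0 z : z != 0 -> 0 < sqmod z.
Proof.
move=> z0; rewrite lt_neqAle sqmod_ge0 andbT eq_sym.
apply: contra z0; case: z => a b; rewrite /sqmod /= paddr_eq0 ?sqr_ge0//.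
by rewrite !sqrf_eq0 eq_complex.
Qed.

Definition sqmod2 (a : R[i] * R[i]) : R := sqmod a.1 + sqmod a.2.

Lemma sqmod2_ge0 a : 0 <= sqmod2 a.
Proof. by apply: addr_ge0; exact: sqmod_ge0. Qed.

Lemma sqmod2_affine b x y :
  sqmod2 (affine b (Complex x y)) = 1 + (x ^+ 2 + y ^+ 2).
Proof. by case: b; rewrite /sqmod2 /sqmod /= ?expr0n ?expr1n /=; ring. Qed.

(* 1 + c z, the momentum z being a function of the squared norm P / Q of the
   fibre coordinate o / l; it is 1 on the section l = 0. *)
Definition potential (p : @hcoord R) : R :=
  let P := sqmod p.2.1 * sqmod2 p.1.1 in
  let Q := sqmod p.2.2 * sqmod2 p.1.2 in
  1 + c * (if Q == 0 then 1 else Z1 (P / Q)).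

(** Changing representatives multiplies P and Q by the same |nu|^2 |lam|^2: the weight 1 / mu of the
    component l cancels against the norm of the second factor. *)
Lemma potential_on_M : function_on_M potential.
Proof.
move=> p _ _ _ [lam [mu [nu [l0 m0 n0 ->]]]]; rewrite /potential /=.
set P := sqmod p.2.1 * sqmod2 p.1.1; set Q := sqmod p.2.2 * sqmod2 p.1.2.
pose t := sqmod nu * sqmod lam.
have t0 : 0 < t by rewrite mulr_gt0 ?sqmod_gt0.
have mM : sqmod mu^-1 * sqmod mu = 1 by rewrite -sqmodM mulVf// sqmod1.
rewrite /sqmod2 /= !sqmodM -!mulrDr.
have -> : sqmod nu * sqmod p.2.1 * (sqmod lam * (sqmod p.1.1.1 + sqmod p.1.1.2)) = t * P.
  by rewrite /t /P /sqmod2; ring.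
have -> : sqmod nu * (sqmod lam * sqmod mu^-1) * sqmod p.2.2 *
    (sqmod mu * (sqmod p.1.2.1 + sqmod p.1.2.2)) = t * Q.
  rewrite -[RHS]mul1r -mM /t /Q /sqmod2; ring.
clearbody P Q t.
by rewrite mulf_eq0 (gt_eqF t0) /= invfM mulrACA divff ?mul1r// (gt_eqF t0).
Qed.

Lemma potential_gt0 p : valid p -> 0 < potential p.
Proof.
move=> _; rewrite /potential; set P := _ * sqmod2 p.1.1; set Q := _ * sqmod2 p.1.2.
have PQ : 0 <= P / Q.
  by apply: divr_ge0; apply: mulr_ge0; rewrite ?sqmod_ge0 ?sqmod2_ge0.
apply: affine_gt0 => //; case: ifP => _; first by rewrite lexx; lra.
by have := Z1_itv PQ; lra.
Qed.

(** Exchanging the pairs (i, j) and (k, l) gives the reciprocal norm, needed for the fibre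
    coordinate l / o. *)
Definition fibre_sqnorm (i j k l : 'I_6) (x : E) : R :=
  (x 0 4 * x 0 4 + x 0 5 * x 0 5) * (1 + (x 0 i * x 0 i + x 0 j * x 0 j))
  * (1 + (x 0 k * x 0 k + x 0 l * x 0 l))^-1.

Lemma fibre_sqnorm_generated i j k l :
  generated (@coordinate R 5) (fibre_sqnorm i j k l).
Proof.
have co (m : 'I_6) : generated (@coordinate R 5) (fun x => x 0 m).
  by apply: gen_atom; exists m.
have sq (m m' : 'I_6) :
    generated (@coordinate R 5) (fun x => x 0 m * x 0 m + x 0 m' * x 0 m').
  by apply: gen_add; apply: gen_mul.
have sq1 (m m' : 'I_6) : generated (@coordinate R 5)
    (fun x => 1 + (x 0 m * x 0 m + x 0 m' * x 0 m')).
  by apply: gen_add => //; exact: gen_cst.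
apply: gen_mul; first exact: gen_mul.
apply: gen_inv => // x; rewrite gt_eqF// ltr_pwDl//.
by rewrite addr_ge0// -expr2 sqr_ge0.
Qed.

Lemma fibre_sqnorm_ge0 i j k l x : 0 <= fibre_sqnorm i j k l x.
Proof.
by rewrite /fibre_sqnorm -!expr2 !mulr_ge0 ?invr_ge0 ?addr_ge0 ?sqr_ge0.
Qed.

Lemma potential_chart1 b1 b2 x :
  potential (chart (b1, b2, true) x) = 1 + c * Z1 (fibre_sqnorm 0 1 2 3 x).
Proof.
rewrite /potential /chart /= !sqmod2_affine sqmod1 mul1r.
rewrite gt_eqF; last by rewrite ltr_pwDl// addr_ge0 ?sqr_ge0.
by rewrite /fibre_sqnorm /sqmod /= -!expr2.
Qed.

Lemma potential_chart2 b1 b2 x :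
  potential (chart (b1, b2, false) x) = 1 + - c * Z2 (fibre_sqnorm 2 3 0 1 x).
Proof.
rewrite /potential /chart /= !sqmod2_affine sqmod1 mul1r.
rewrite /fibre_sqnorm /sqmod /= -!expr2.
set A := 1 + (x 0 0 ^+ 2 + _); set B := 1 + (x 0 2 ^+ 2 + _).
have A0 : 0 < A by rewrite ltr_pwDl// addr_ge0 ?sqr_ge0.
have B0 : 0 < B by rewrite ltr_pwDl// addr_ge0 ?sqr_ge0.
set N := x 0 4 ^+ 2 + _; have N0 : 0 <= N by rewrite addr_ge0 ?sqr_ge0.
rewrite mulf_eq0 (gt_eqF B0) orbF mulNr -mulrN; congr (1 + c * _).
(* On the section l = 0 the default momentum 1 agrees with - Z2 0. *)
case: eqP => [->|/eqP Nn0]; first by rewrite !mul0r Z2_0 opprK.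
rewrite -[N * B / A]invrK Z2_V; first by rewrite opprK invf_div.
by rewrite invr_gt0 divr_gt0// mulr_gt0// lt_neqAle eq_sym Nn0.
Qed.

Lemma potential_smooth : smooth_on_M potential.
Proof.
split; first exact: potential_on_M.
move=> [[b1 b2] []].
  have -> : potential \o chart (b1, b2, true) =
      (fun x => 1 + c * Z1 (fibre_sqnorm 0 1 2 3 x)).
    by apply/funext => x; exact: potential_chart1.
  by have [] := Z_smooth 1 c (fibre_sqnorm_generated 0 1 2 3) (fibre_sqnorm_ge0 _ _ _ _).
have -> : potential \o chart (b1, b2, false) =
    (fun x => 1 + - c * Z2 (fibre_sqnorm 2 3 0 1 x)).
  by apply/funext => x; exact: potential_chart2.
by have [] := Z_smooth 1 (- c) (fibre_sqnorm_generated 2 3 0 1) (fibre_sqnorm_ge0 _ _ _ _).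
Qed.

Lemma potential_momentum_chart (rho : R -> R) (b : bool * bool) (q : E) :
  (forall z, -1 < z < 1 -> 0 < rho z) ->
  (forall z, -1 < z < 1 -> Z1 (rho z) = z) ->
  momentum_domain q ->
  potential (momentum_chart (fun z => Num.sqrt (rho z)) b q) = 1 + c * q 0 4.
Proof.
move=> rho0 Z1rho Uq; rewrite /potential /momentum_chart /= !sqmod2_affine sqmod1 mul1r.
have nE (i j : 'I_6) : q 0 i ^+ 2 + q 0 j ^+ 2 = normsq i j q by [].
rewrite !nE.
have A0 : 0 < 1 + normsq 0 1 q by rewrite ltr_pwDl// addr_ge0 ?sqr_ge0.
have B0 : 0 < 1 + normsq 2 3 q by rewrite ltr_pwDl// addr_ge0 ?sqr_ge0.
rewrite (gt_eqF B0); congr (1 + c * _).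
rewrite -[RHS]Z1rho//; congr Z1.
have rho_ge0 : 0 <= rho (q 0 4) by rewrite ltW// rho0.
have BA_ge0 : 0 <= (1 + normsq 2 3 q) / (1 + normsq 0 1 q) by rewrite divr_ge0 ?ltW.
rewrite /sqmod /= !exprMn -!mulrDr cos2Dsin2 mulr1 !sqr_sqrtr//.
by field; rewrite !gt_eqF.
Qed.

End Potential.

Theorem proposition4p3 (R : realType) (s x1 x2 : R)
    (hs : 0 < s) (hx1 : 0 < x1 < 1) (hx2 : -1 < x2 < 0) :
  exists Theta kappa : R -> R,
    [/\ momentum_profile Theta,
        fibre_norm Theta kappa,
        forall p, momentum_domain p ->
          kahler_form (admissible_metric s x1 x2 Theta) (admissible_J Theta) p
          = admissible_form s x1 x2 p &
        conformal_to_einstein_maxwell kappa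
          (admissible_metric s x1 x2 Theta) (admissible_J Theta)].
Proof.
have [c [S [k [H [F [c_itv HE FE H_gt0 ode]]]]]] := em_profile hx1 hx2.
have p_gt0 z : -1 <= z <= 1 -> 0 < (base_poly x1 x2).[z].
  by move=> z_itv; rewrite base_polyE mulr_gt0// affine_gt0//; lra.
have [L [Z1 [Z2 [rhoE Z1K Z1_itv [Z2_0 Z2_V] Z_smooth]]]] :=
  momentum_inverse HE H_gt0 p_gt0.
have F_gt0 z : -1 < z < 1 -> 0 < F.[z].
  move=> z_itv; rewrite FE hornerM mulr_gt0//; last by apply: H_gt0; lra.
  by rewrite !hornerE; move/andP: z_itv => [? ?]; nra.
have odeE z : (1 + c * z) ^+ 2 * F^`()^`().[z]
  - 10 * c * (1 + c * z) * F^`().[z] + 30 * c ^+ 2 * F.[z]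
  = 4 * (x1 - x2) * (1 + c * z) ^+ 2 - S * ((1 + x1 * z) * (1 + x2 * z)).
  by rewrite ode base_polyE.
have ThetaE : Theta_of x1 x2 F =
    (fun z => ((1 - 'X^2) * H).[z] / (base_poly x1 x2).[z]).
  by apply/funext => z; rewrite /Theta_of base_polyE FE.
have Hend (e : R) : e ^+ 2 = 1 -> H.[e] = (base_poly x1 x2).[e].
  by move=> e2; rewrite HE hornerD [((_ - _) * k).[e]]hornerM !hornerE e2 subrr mul0r addr0.
(* The square root halves the logarithmic derivative 2 / Theta of [norm_of L]. *)
exists (Theta_of x1 x2 F), (fun z => Num.sqrt (norm_of L z)); split.
- rewrite ThetaE; apply: ratio_momentum_profile => //.
  + by apply: Hend; rewrite expr1n.
  + by apply: Hend; rewrite sqrrN expr1n.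
  + by move=> z z_itv; apply: H_gt0; lra.
- move=> z z_itv; have [rho0 rhoD] := rhoE _ z_itv.
  split; first by rewrite sqrtr_gt0.
  apply: is_derive_eq (is_derive_comp (is_derive1_sqrt rho0) rhoD) _.
  rewrite ThetaE invf_div -{2}(sqr_sqrtr (ltW rho0)).
  have q0 : Num.sqrt (norm_of L z) != 0 by rewrite gt_eqF// sqrtr_gt0.
  have F0 : ((1 - 'X^2) * H).[z] != 0 by rewrite -FE gt_eqF// F_gt0.
  by field; rewrite q0 F0.
- by move=> p Up; apply: (admissible_kahler_form (c := c)).
have fE b q : momentum_domain q ->
    (potential c Z1 \o momentum_chart (fun z => Num.sqrt (norm_of L z)) b) q = 1 + c * q 0 4.
  move=> Uq; apply: potential_momentum_chart => // z z_itv.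
    by have [] := rhoE _ z_itv.
  by apply: Z1K; lra.
exists (potential c Z1); split.
- exact: potential_smooth Z2_0 Z2_V Z_smooth.
- by move=> p; apply: potential_gt0.
- by move=> b; apply: (admissible_killing (c := c)) => //; exact: fE.
exists (S / s) => b p Up /=.
by apply: (admissible_scalar_curvature (c := c) (F := F)) => //; exact: fE.
Qed.
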